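(* Let $\psi:\mathbb{R}^d\to(-\infty,\infty]$ be proper, closed, convex, bounded from below with $\int e^{-\psi}<\infty$; fix $\lambda>0$ and let $\pi^\lambda(x)\propto e^{-\psi^\lambda(x)}$. Assume (i) $\limsup_{\|x\|\to\infty}\|\mathrm{prox}^\lambda_\psi(x)\|/\|x\|=l<1$. Consider the HMC algorithm targeting $\pi^\lambda$ with identity mass matrix and step size $\varepsilon>0$: from $x_0$, draw $z_0\sim N(0,\mathbb I_d)$ and a number of leapfrog steps $L\ge1$ from a distribution $\mathcal L$, apply $L$ leapfrog steps ($z\leftarrow z-\frac\varepsilon2\nabla\psi^\lambda(x)$, $x\leftarrow x+\varepsilon z$, $z\leftarrow z-\frac\varepsilon2\nabla\psi^\lambda(x)$) to reach $(x_{L\varepsilon},z_{L\varepsilon})$, and accept $x_{L\varepsilon}$ with probability $\min\{1,e^{-H(x_{L\varepsilon},z_{L\varepsilon})+H(x_0,z_0)}\}$ where $H(x,z)=\psi^\lambda(x)+\frac12 z^Tz$. Assume (ii) $\Pr_{\mathcal L}[L=1]>0$ and for any $(x_0,z_0)\in\mathbb{R}^{2d}$ and $\varepsilon>0$ there is $s<\infty$ with $\mathbb{E}_{\mathcal L}[e^{s\|x_{L\varepsilon}\|}]<\infty$. Let $q_H(x,\cdot)$ denote the density of the proposal $x_{L\varepsilon}$ from $x_0=x$, $R(x)=\{y:\pi^\lambda(y)q_H(y,x)\le\pi^\lambda(x)q_H(x,y)\}$ and $I(x)=\{y:\|y\|\le\|x\|\}$. If $\lim_{\|x\|\to\infty}\int_{R(x)\cap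 I(x)}q_H(x,y)\,dy=0$, then the $\pi^\lambda$-HMC chain is geometrically ergodic for all sufficiently small $\varepsilon$.
   Context: Moreau-Yosida envelope: $\psi^\lambda(x)=\inf_y\{\psi(y)+\frac1{2\lambda}\|y-x\|^2\}$; proximal mapping: $\mathrm{prox}^\lambda_\psi(x)=\arg\min_y\{\psi(y)+\frac1{2\lambda}\|y-x\|^2\}$. $\nabla\psi^\lambda(x)=\frac1\lambda(x-\mathrm{prox}^\lambda_\psi(x))$. *)

(* Defs.v *)
From HB Require Import structures.
From mathcomp Require Import all_boot all_order all_algebra.
From mathcomp Require Import all_classical all_reals all_analysis.
Set Implicit Arguments. Unset Strict Implicit. Unset Printing Implicit Defensive.
Import Order.TTheory GRing.Theory Num.Theory.
Import numFieldNormedType.Exports.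
Local Open Scope classical_set_scope.
Local Open Scope ring_scope.

Section HMCDefs.
Variables (R : realType) (d : nat).
Notation V := 'rV[R]_d.

Definition sqnorm (x : V) : R := \sum_(i < d) x ord0 i ^+ 2.
Definition enorm (x : V) : R := Num.sqrt (sqnorm x).

Definition borelRd (A : set V) : Prop := <<s [set: V], @open V >> A.

(* Lebesgue integral over R^n of a nonnegative extended-real function,
   written as the iterated one-dimensional Lebesgue integral
   (equal to the integral against the d-dimensional Lebesgue measure for
   nonnegative Borel functions, by Tonelli). *)
Fixpoint intRn (n : nat) : ('rV[R]_n -> \bar R) -> \bar R :=
  match n return ('rV[R]_n -> \bar R) -> \bar R with
  | 0 => fun f => f 0
  | n'.+1 => fun f =>
      (\int[@lebesgue_measure R]_t
         intRn (fun v : 'rV[R]_n' => f (row_mx (t%:M : 'rV[R]_1) v)))%E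
  end.

Definition gauss (z : V) : R :=
  (2 * pi) `^ (- (d%:R / 2)) * expR (- (sqnorm z / 2)).

Definition proper_fun (psi : V -> \bar R) : Prop :=
  (exists x, (psi x < +oo)%E) /\ (forall x, (-oo < psi x)%E).

Definition closed_fun (psi : V -> \bar R) : Prop :=
  closed [set p : V * R | (psi p.1 <= p.2%:E)%E].

Definition convex_fun (psi : V -> \bar R) : Prop :=
  forall (x y : V) (t : R), 0 <= t <= 1 ->
    (psi (t *: x + (1 - t) *: y)%R <= t%:E * psi x + (1 - t)%:E * psi y)%E.

Definition bounded_below (psi : V -> \bar R) : Prop :=
  exists m : R, forall x, (m%:E <= psi x)%E.

Definition moreau (psi : V -> \bar R) (lam : R) (x : V) : \bar R :=
  ereal_inf [set (psi y + ((2 * lam)^-1 * sqnorm (y - x)%R)%:E)%E | y in [set: V]].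

(* proximal mapping: a minimiser of y |-> psi y + |y-x|^2/(2 lam)
   (unique under the standing assumptions) *)
Definition prox (psi : V -> \bar R) (lam : R) (x : V) : V :=
  xget 0 [set y : V | forall y' : V,
     (psi y + ((2 * lam)^-1 * sqnorm (y - x)%R)%:E <=
      psi y' + ((2 * lam)^-1 * sqnorm (y' - x)%R)%:E)%E].

Definition grad_moreau (psi : V -> \bar R) (lam : R) (x : V) : V :=
  lam^-1 *: (x - prox psi lam x).

Definition pi_unnorm (psi : V -> \bar R) (lam : R) (x : V) : \bar R :=
  expeR (- moreau psi lam x)%E.
Definition pi_const (psi : V -> \bar R) (lam : R) : R :=
  fine (intRn (pi_unnorm psi lam)).
Definition pi_dens (psi : V -> \bar R) (lam : R) (x : V) : R :=
  fine (pi_unnorm psi lam x) / pi_const psi lam.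
Definition pi_prob (psi : V -> \bar R) (lam : R) (A : set V) : R :=
  fine (intRn (fun y => ((\1_A y : R)%:E * pi_unnorm psi lam y)%E))
  / pi_const psi lam.

Definition leapfrog1 (psi : V -> \bar R) (lam eps : R) (p : V * V) : V * V :=
  let z1 := p.2 - (eps / 2) *: grad_moreau psi lam p.1 in
  let x1 := p.1 + eps *: z1 in
  (x1, z1 - (eps / 2) *: grad_moreau psi lam x1).

Definition leapfrog (psi : V -> \bar R) (lam eps : R) (L : nat) (x z : V) : V * V :=
  iter L (leapfrog1 psi lam eps) (x, z).

Definition hamiltonian (psi : V -> \bar R) (lam : R) (x z : V) : R :=
  fine (moreau psi lam x) + sqnorm z / 2.

Definition accept_prob (psi : V -> \bar R) (lam eps : R) (L : nat) (x z : V) : R :=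
  let q := leapfrog psi lam eps L x z in
  Num.min 1 (expR (- hamiltonian psi lam q.1 q.2 + hamiltonian psi lam x z)).

(* The HMC Markov operator: (P f)(x) = E[f(X_1) | X_0 = x], for f >= 0.
   pL is the probability mass function of the number of leapfrog steps. *)
Definition hmc_op (psi : V -> \bar R) (lam eps : R) (pL : nat -> R)
    (f : V -> \bar R) (x : V) : \bar R :=
  (\sum_(0 <= L <oo) (pL L)%:E *
    intRn (fun z : V =>
      let a := accept_prob psi lam eps L x z in
      (gauss z)%:E * (a%:E * f (leapfrog psi lam eps L x z).1
                      + (1 - a)%R%:E * f x)))%E.

Definition hmc_kernel_n (psi : V -> \bar R) (lam eps : R) (pL : nat -> R)
    (n : nat) (x : V) (A : set V) : \bar R :=
  iter n (hmc_op psi lam eps pL) (fun y => (\1_A y : R)%:E) x.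

Definition proposal_prob (psi : V -> \bar R) (lam eps : R) (pL : nat -> R)
    (x : V) (A : set V) : \bar R :=
  (\sum_(0 <= L <oo) (pL L)%:E *
    intRn (fun z : V => (gauss z * \1_A (leapfrog psi lam eps L x z).1)%:E))%E.

Definition is_proposal_density (psi : V -> \bar R) (lam eps : R) (pL : nat -> R)
    (q : V -> V -> R) : Prop :=
  (forall x y, 0 <= q x y) /\
  forall x A, borelRd A ->
    proposal_prob psi lam eps pL x A = intRn (fun y => (\1_A y * q x y)%:E).

Definition geometrically_ergodic (psi : V -> \bar R) (lam eps : R)
    (pL : nat -> R) : Prop :=
  exists (rho : R) (M : V -> R), 0 <= rho < 1 /\
  exists N : set V, borelRd N /\ pi_prob psi lam N = 0 /\
  forall x, ~ N x -> forall (n : nat) (A : set V), borelRd A ->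
    (`| hmc_kernel_n psi lam eps pL n x A - (pi_prob psi lam A)%:E |
       <= (M x * rho ^+ n)%:E)%E.

Definition limsup_infty (g : V -> R) : \bar R :=
  ereal_inf [set ereal_sup [set (g x)%:E | x in [set x | M < enorm x]]
            | M in [set: R]].

End HMCDefs.

(* Main.v *)
(* The gradient g of the Moreau envelope U is co-coercive:
     U y >= U x + <g x, y - x> + lam/2 |g y - g x|^2.
   Hence, if eps^2 <= 2 lam, a single leapfrog step from (x, z) raises the
   Hamiltonian by at most |z|^2/2, whatever x is, so it is accepted with
   probability at least exp(- |z|^2/2); it also satisfies
   U x1 <= U x - eps^2/4 |g x|^2 + |z|^2.  By (i), |g|^2 dominates U at
   infinity.  A trajectory of any other length increases U by at most
   |z|^2/2 + 1 on average over the accept/reject step.  Since L = 1 has positive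
   probability, U satisfies a geometric drift condition.  One accepted leapfrog
   step also minorizes the kernel on sublevel sets of U, the target is invariant
   because the leapfrog flow composed with the momentum flip is a
   volume-preserving involution, and Harris' theorem in the form of Hairer and
   Mattingly yields the geometric rate. *)
Require Import Defs.
From HB Require Import structures.
From mathcomp Require Import all_boot all_order all_algebra.
From mathcomp Require Import all_classical all_reals all_analysis.
From mathcomp Require Import measurable_realfun ring lra.
Import Order.TTheory GRing.Theory Num.Theory.
Import numFieldNormedType.Exports.
Set Implicit Arguments. Unset Strict Implicit. Unset Printing Implicit Defensive.
Local Open Scope classical_set_scope.
Local Open Scope ring_scope.

(** * Euclidean inner product *)

Section dot.
Context {R : realType} {d : nat}.
Implicit Types x y z : 'rV[R]_d.

(** Taking [U] itself as Lyapunov function, rather than an exponential of it or of the norm, is what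
    tames trajectories of arbitrary length. If such a trajectory raises [U] by [u] beyond the
    initial kinetic energy, it is accepted with probability at most [exp (- u)], and
    [u exp (- u) <= 1]: the harm is an additive constant, which the contraction due to one-step
    moves absorbs. For an exponential of [U] the same harm would be a multiplicative factor. The
    threshold [eps ^ 2 <= 2 lam] is used twice, each time to close a quadratic form: in the energy
    bound and in the descent bound. The integral over R^d is given as an iterated one. To have
    Tonelli and monotone convergence, a sigma-finite measure with the same integrals of nonnegative
    measurable functions is constructed, and the sampler is treated as an operator on such
    functions; terms are moved across inequalities so that integrals need not be subtracted. After
    the growth estimates, envelope and gradient are abstracted to a co-coercive pair [W], [G]. *)

Definition dot x y : R := \sum_(i < d) x ord0 i * y ord0 i.

Lemma dotC x y : dot x y = dot y x.
Proof. by apply: eq_bigr => i _; rewrite mulrC. Qed.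

Lemma dotDl x y z : dot (x + y) z = dot x z + dot y z.
Proof. by rewrite -big_split; apply: eq_bigr => i _; rewrite mxE mulrDl. Qed.

Lemma dotZl a x y : dot (a *: x) y = a * dot x y.
Proof. by rewrite mulr_sumr; apply: eq_bigr => i _; rewrite mxE mulrA. Qed.

Lemma dotNl x y : dot (- x) y = - dot x y.
Proof. by rewrite -scaleN1r dotZl mulN1r. Qed.

Lemma dotDr x y z : dot x (y + z) = dot x y + dot x z.
Proof. by rewrite dotC dotDl !(dotC x). Qed.

Lemma dotZr a x y : dot x (a *: y) = a * dot x y.
Proof. by rewrite dotC dotZl dotC. Qed.

Lemma dotNr x y : dot x (- y) = - dot x y.
Proof. by rewrite dotC dotNl dotC. Qed.

Definition dotE := (dotDl, dotDr, dotZl, dotZr, dotNl, dotNr).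

Lemma sqnormE x : sqnorm x = dot x x.
Proof. by apply: eq_bigr => i _; rewrite expr2. Qed.

Lemma sqnorm_ge0 x : 0 <= sqnorm x.
Proof. by apply: sumr_ge0 => i _; rewrite sqr_ge0. Qed.

Lemma sqnormN x : sqnorm (- x) = sqnorm x.
Proof. by rewrite !sqnormE !dotE opprK. Qed.

Lemma sqnormZ a x : sqnorm (a *: x) = a ^+ 2 * sqnorm x.
Proof. by rewrite !sqnormE !dotE mulrA. Qed.

Lemma sqnormB x y : sqnorm (x - y) = sqnorm x - 2 * dot x y + sqnorm y.
Proof. by rewrite !sqnormE !dotE (dotC y x); ring. Qed.

Lemma young a x y : 2 * a * dot x y <= a ^+ 2 * sqnorm x + sqnorm y.
Proof.
by have := sqnorm_ge0 (a *: x - y); rewrite sqnormB sqnormZ dotZl; lra.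
Qed.

Lemma sqr_coord_le x i : x ord0 i ^+ 2 <= sqnorm x.
Proof.
by rewrite /sqnorm (bigD1 i)//= lerDl; apply: sumr_ge0 => j _; rewrite sqr_ge0.
Qed.

Lemma continuous_sumr (T : topologicalType) (F : 'I_d -> T -> R) :
  (forall i, continuous (F i)) -> continuous (fun t => \sum_i F i t).
Proof.
by move=> cF; apply: continuous_big => //; exact: add_continuous.
Qed.

Lemma dot_continuous y : continuous (dot y).
Proof.
apply: continuous_sumr => i x.
by apply: continuousM; [exact: cst_continuous|exact: coord_continuous].
Qed.

Lemma sqnorm_continuous : continuous (@sqnorm R d).
Proof.
apply: continuous_sumr => i x.
rewrite (_ : (fun _ => _) = fun x : 'rV[R]_d => x ord0 i * x ord0 i).
  by apply: continuousM; exact: coord_continuous.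
by apply/funext => z; rewrite expr2.
Qed.

Lemma subr_continuous z : continuous (fun x => x - z).
Proof.
by move=> x; apply: continuousB; [exact: cvg_id|exact: cst_continuous].
Qed.

Lemma dotB_continuous y z : continuous (fun x => dot y (x - z)).
Proof.
move=> x; apply: (@continuous_comp _ _ _ (fun x => x - z) (dot y)).
  exact: subr_continuous.
exact: dot_continuous.
Qed.

Lemma sqnormB_continuous z : continuous (fun x => sqnorm (x - z)).
Proof.
move=> x; apply: (@continuous_comp _ _ _ (fun x => x - z) (@sqnorm R d)).
  exact: subr_continuous.
exact: sqnorm_continuous.
Qed.

Lemma sqnorm0 : sqnorm (0 : 'rV[R]_d) = 0.
Proof. by rewrite -(scale0r 0) sqnormZ expr0n mul0r. Qed.

Lemma dot0r x : dot x 0 = 0.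
Proof. by rewrite -(scale0r 0) dotZr mul0r. Qed.

End dot.

(** * Moreau envelope *)

(** Stands in for the limit [t -> 0] in a first-order optimality condition. If [A] were negative,
    [t = - A / (2 * (B - A))] would be an admissible point at which [A + t * B] is negative. *)
Lemma ge0_of_affine_ge0 (R : realFieldType) (A B : R) : 0 <= B ->
  (forall t, 0 < t <= 1 -> 0 <= A + t * B) -> 0 <= A.
Proof.
move=> B0 h; rewrite leNgt; apply/negP => A0.
have D0 : 0 < 2 * (B - A) by lra.
have := h (- A / (2 * (B - A))).
have -> : 0 < - A / (2 * (B - A)) <= 1.
  by rewrite divr_gt0 ?oppr_gt0//= ler_pdivrMr// mul1r; lra.
move=> /(_ isT).
have -> : A + - A / (2 * (B - A)) * B = A * (B - 2 * A) / (2 * (B - A)).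
  by field; apply: lt0r_neq0; lra.
apply/negP; rewrite -ltNge pmulr_llt0 ?invr_gt0//; nra.
Qed.

(* For a convex differentiable [W] with gradient [G], equivalent to
   [1/lam]-Lipschitz continuity of [G]. *)
Definition cocoercive (R : realType) d (lam : R) (W : 'rV[R]_d -> R)
    (G : 'rV[R]_d -> 'rV[R]_d) :=
  forall x y, W x + dot (G x) (y - x) + lam / 2 * sqnorm (G y - G x) <= W y.

Section moreau.
Context {R : realType} {d : nat} (psi : 'rV[R]_d -> \bar R) (lam : R).
Hypothesis psi_proper : proper_fun psi.
Hypothesis psi_closed : closed_fun psi.
Hypothesis psi_convex : convex_fun psi.
Hypothesis lam0 : 0 < lam.
Variable m : R.
Hypothesis psi_ge : forall x, (m%:E <= psi x)%E.
Implicit Types x y : 'rV[R]_d.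

Let c0 : 0 < (2 * lam)^-1. Proof. by rewrite invr_gt0 mulr_gt0. Qed.

(** Closedness is a property of the epigraph, so the minimisation runs over pairs [(y, r)] of the
    epigraph, where the objective [r + c |y - x|^2] is real-valued and continuous. The lower bound
    [m] makes its sublevel set bounded, hence compact. *)
Lemma prox_exists x : exists p, forall y,
  (psi p + ((2 * lam)^-1 * sqnorm (p - x)%R)%:E <=
   psi y + ((2 * lam)^-1 * sqnorm (y - x)%R)%:E)%E.
Proof.
set c := (2 * lam)^-1.
have [[y0 y0oo] psiNy] := psi_proper.
have fin y : (psi y < +oo)%E -> psi y = (fine (psi y))%:E.
  by move=> h; rewrite fineK// fin_numElt psiNy h.
pose phi (p : 'rV[R]_d * R) := p.2 + c * sqnorm (p.1 - x).
have cphi : continuous phi.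
  move=> p; apply: continuousD; first exact: cvg_snd.
  apply: continuousM; first exact: cst_continuous.
  apply: (@continuous_comp _ _ _ (fun p : 'rV[R]_d * R => p.1 - x) (@sqnorm R d)).
    by apply: cvgB; [exact: cvg_fst|exact: cvg_cst].
  exact: sqnorm_continuous.
pose B := phi (y0, fine (psi y0)).
pose S := [set p : 'rV[R]_d * R | (psi p.1 <= p.2%:E)%E] `&` phi @^-1` [set r | r <= B].
have Sy0 : S (y0, fine (psi y0)) by split => //=; rewrite -fin.
have clS : closed S.
  apply: closedI; first exact: psi_closed.
  by move/continuous_closedP : cphi; apply; exact: closed_le.
(* With [t = (B - m) / c], a coordinate [u] of [v - x] satisfies [u ^+ 2 <= t]; then [|u| <= 1 + t],
   which avoids a square root. *)
pose b := 1 + (B - m) / c.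
have cS : compact S.
  apply: (subclosed_compact clS (B := [set v : 'rV[R]_d |
      forall i, `[x ord0 i - b, x ord0 i + b]%classic (v ord0 i)] `*` `[m, B]%classic)).
    apply: compact_setX; last exact: segment_compact.
    by apply: (@rV_compact _ _ (fun i => `[x ord0 i - b, x ord0 i + b]%classic)) =>
      i; exact: segment_compact.
  move=> [v r] [/= vr]; rewrite /phi /= => hB.
  have mr : m <= r by rewrite -lee_fin; exact: le_trans (psi_ge v) vr.
  have s0 := sqnorm_ge0 (v - x).
  have cs : 0 <= c * sqnorm (v - x) by rewrite mulr_ge0// ltW.
  split => /=; last by rewrite in_itv /= mr /=; lra.
  move=> i; rewrite in_itv /=.
  have h1 : sqnorm (v - x) <= (B - m) / c by rewrite ler_pdivlMr// mulrC; lra.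
  have := sqr_coord_le (v - x) i; rewrite !mxE.
  have : 0 <= (B - m) / c by exact: le_trans s0 h1.
  rewrite /b; move: h1; set t := (B - m) / c => h1 t0 h2.
  by apply/andP; split; nra.
have [[p r]] := compact_EVT_min (ex_intro _ _ Sy0) cS
  (continuous_subspaceT cphi).
rewrite inE => -[/= pr pB] pmin; exists p => y.
have prE : (psi p + (c * sqnorm (p - x))%:E <= (phi (p, r))%:E)%E.
  by rewrite /phi /= EFinD leeD2r.
apply: (le_trans prE).
have [yoo|] := ltP (psi y) +oo%E; last first.
  by rewrite leye_eq => /eqP ->; rewrite addye// leey.
have [yB|yB] := leP (phi (y, fine (psi y))) B.
  have /pmin : (y, fine (psi y)) \in S.
    by rewrite inE; split => //=; rewrite -fin.
  move=> h; apply: (@le_trans _ _ (phi (y, fine (psi y)))%:E).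
    by rewrite lee_fin.
  by rewrite /phi /= EFinD -fin.
rewrite (fin _ yoo) -EFinD lee_fin; exact: le_trans pB (ltW yB).
Qed.

Lemma prox_min x y :
  (psi (prox psi lam x) + ((2 * lam)^-1 * sqnorm (prox psi lam x - x)%R)%:E <=
   psi y + ((2 * lam)^-1 * sqnorm (y - x)%R)%:E)%E.
Proof.
rewrite /prox; case: xgetP => [p _ h|h]; first exact: h.
by have [p hp] := prox_exists x; have := h p; case.
Qed.

Lemma psi_prox_fin_num x : psi (prox psi lam x) \is a fin_num.
Proof.
have [[y0 y0oo] psiNy] := psi_proper.
rewrite fin_numElt psiNy/=; have := prox_min x y0.
rewrite ltNge leye_eq; apply: contraPN => /eqP ->.
by rewrite addye// leye_eq; apply/negP; rewrite -ltey lte_add_pinfty// ltry.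
Qed.

Definition psi_prox x : R := fine (psi (prox psi lam x)).

Lemma psi_proxE x : psi (prox psi lam x) = (psi_prox x)%:E.
Proof. by rewrite fineK// psi_prox_fin_num. Qed.

Lemma moreauE x : moreau psi lam x =
  (psi_prox x + lam / 2 * sqnorm (grad_moreau psi lam x))%:E.
Proof.
have -> : lam / 2 * sqnorm (grad_moreau psi lam x) =
    (2 * lam)^-1 * sqnorm (prox psi lam x - x).
  by rewrite /grad_moreau sqnormZ -sqnormN opprB; field; rewrite gt_eqF.
rewrite EFinD -psi_proxE; apply/le_anti/andP; split.
  by apply: ereal_inf_lbound; exists (prox psi lam x).
by apply: le_ereal_inf_tmp => _ [y _ <-]; exact: prox_min.
Qed.

(** First-order optimality: [grad_moreau] at [x] is a subgradient of [psi] at the proximal point.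
    The minimiser is compared with the points of the segment towards another proximal point, where
    convexity bounds [psi]; the quadratic term leaves a remainder of order [t ^ 2], removed by
    letting [t] tend to 0. *)
Lemma psi_prox_subgradient x y :
  psi_prox x + dot (grad_moreau psi lam x) (prox psi lam y - prox psi lam x)
    <= psi_prox y.
Proof.
set p := prox psi lam x; set q := prox psi lam y.
rewrite -subr_ge0.
apply: (@ge0_of_affine_ge0 _ _ ((2 * lam)^-1 * sqnorm (q - p))).
  by rewrite mulr_ge0 ?sqnorm_ge0// ltW.
move=> t /andP[t0 t1].
have := prox_min x (t *: q + (1 - t) *: p).
have hc := psi_convex q p (t := t) ltac:(by rewrite ltW).
move=> /le_trans /(_ (leeD2r _ hc)).
rewrite -/p !psi_proxE -!EFinM -!EFinD lee_fin -/p -/q => h.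
suff : 0 <= t * (psi_prox y - (psi_prox x + dot (grad_moreau psi lam x) (q - p))
    + t * ((2 * lam)^-1 * sqnorm (q - p))) by rewrite pmulr_rge0.
suff e : t * (dot (grad_moreau psi lam x) (q - p)) =
    (2 * lam)^-1 * sqnorm (p - x) - (2 * lam)^-1 * sqnorm (t *: q + (1 - t) *: p - x)
    + t * (t * ((2 * lam)^-1 * sqnorm (q - p))) by lra.
rewrite /grad_moreau -/p; move: p q {h hc} => p q.
rewrite !sqnormE !dotE (dotC p q) (dotC x p) (dotC x q).
by field; rewrite gt_eqF.
Qed.

Definition menv x : R := fine (moreau psi lam x).
Notation g := (grad_moreau psi lam).

Lemma menvE x : menv x = psi_prox x + lam / 2 * sqnorm (g x).
Proof. by rewrite /menv moreauE. Qed.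

(** Substituting [prox z = z - lam *: g z] turns the subgradient inequality at proximal points into
    this one: the three quadratic terms in [g x] and [g y] combine to [lam / 2 |g y - g x|^2]. *)
Lemma menv_cocoercive : cocoercive lam menv g.
Proof.
move=> x y; rewrite !menvE; have := psi_prox_subgradient x y.
have e z : prox psi lam z = z - lam *: g z.
  by rewrite scalerA divff ?gt_eqF// scale1r opprB addrC subrK.
rewrite !e; move: (g x) (g y) => a b.
rewrite !sqnormE !dotE (dotC b a); lra.
Qed.

Lemma menv_ge x : m <= menv x.
Proof.
rewrite menvE -[m]addr0 lerD//; last first.
  by rewrite mulr_ge0 ?sqnorm_ge0// divr_ge0// ltW.
by rewrite -lee_fin -psi_proxE.
Qed.

End moreau.

(** * Consequences of co-coercivity: Lipschitz gradient, descent inequality, continuity *)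

Section cocoercive.
Context {R : realType} {d : nat} (W : 'rV[R]_d -> R) (G : 'rV[R]_d -> 'rV[R]_d).
Variable lam : R.
Hypothesis lam0 : 0 < lam.
Hypothesis coco : cocoercive lam W G.
Implicit Types x y : 'rV[R]_d.

Lemma coco_monotone x y :
  lam * sqnorm (G y - G x) <= dot (G y - G x) (y - x).
Proof.
have h1 := coco x y; have h2 := coco y x.
have -> : dot (G y - G x) (y - x) = - dot (G x) (y - x) - dot (G y) (x - y).
  by move: (G x) (G y) => a b; rewrite !dotE; ring.
move: h1 h2; move: (G x) (G y) (W x) (W y) => a b u v.
by rewrite -(sqnormN (a - b)) opprB; lra.
Qed.

(** Young's inequality with weight [lam] plays the role of Cauchy-Schwarz:
    [2 lam <h, v> <= lam^2 |h|^2 + |v|^2], while monotonicity bounds the left side below by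
    [2 lam^2 |h|^2]. *)
Lemma coco_lipschitz x y : lam ^+ 2 * sqnorm (G y - G x) <= sqnorm (y - x).
Proof.
have := coco_monotone x y; have := young lam (G y - G x) (y - x).
move: (G y - G x) (y - x) lam0 => h v.
move: (dot h v) (sqnorm h) (sqnorm v) => t p q lam_gt0 h2 h1.
have : 2 * lam * (lam * p) <= 2 * lam * t by apply: ler_wpM2l => //; lra.
by lra.
Qed.

(** Stated by coordinates because measurability of a vector-valued map is later checked coordinate
    by coordinate. *)
Lemma coco_coord_continuous i : continuous (fun x => G x ord0 i).
Proof.
move=> x.
pose s y := Num.sqrt (lam ^- 2 * sqnorm (y - x)).
have cs : s y @[y --> x] --> (0 : R).
  rewrite (_ : 0 = s x); last by rewrite /s subrr sqnorm0 mulr0 sqrtr0.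
  apply: (@continuous_comp _ _ _ (fun y => lam ^- 2 * sqnorm (y - x))
    (@Num.sqrt R) x); last exact: sqrt_continuous.
  apply: continuousM; first exact: cst_continuous.
  exact: sqnormB_continuous.
apply: (@squeeze_cvgr _ (nbhs x) _ _ (fun y => G x ord0 i - s y) (fun y => G x ord0 i + s y)).
- near=> y.
  rewrite -ler_distlC distrC -[`|_|]sqrtr_sqr ler_sqrt; last first.
    by rewrite mulr_ge0 ?sqnorm_ge0// invr_ge0 sqr_ge0.
  have := coco_lipschitz x y; move: (G x) (G y) => a b h.
  have := sqr_coord_le (b - a) i; rewrite !mxE => /le_trans; apply.
  rewrite mulrC ler_pdivlMr ?exprn_gt0// mulrC; exact: h.
- by rewrite -[X in _ --> X]subr0; apply: cvgB => //; exact: cvg_cst.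
- by rewrite -[X in _ --> X]addr0; apply: cvgD => //; exact: cvg_cst.
Unshelve. all: by end_near. Qed.

(** The usual descent lemma, obtained without integrating the gradient along a segment: in the
    co-coercivity inequality from [y] to [x], the square [lam / 2 |G y - G x|^2] pays, through
    Young, for replacing [G y] by [G x] in the linear term. *)
Lemma coco_descent x y :
  W y <= W x + dot (G x) (y - x) + (2 * lam)^-1 * sqnorm (y - x).
Proof.
have := coco y x; move: (G x) (G y) (W x) (W y) => a b u v.
have := young lam (b - a) (y - x).
have -> : dot b (x - y) = - dot a (y - x) - dot (b - a) (y - x).
  by rewrite !dotE; ring.
rewrite -(sqnormN (a - b)) opprB.
move: (sqnorm (b - a)) (dot (b - a) _) (dot a _) (sqnorm _) => h p q s h1 h2.
have l2 : 0 < 2 * lam by rewrite mulr_gt0.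
rewrite -(ler_pM2l l2) !mulrDr mulVKf ?gt_eqF//.
by have := ler_wpM2l (ltW l2) h2; lra.
Qed.

Lemma coco_continuous : continuous W.
Proof.
move=> x.
have cd := @dotB_continuous _ _ (G x) x.
have cq : continuous (fun y => (2 * lam)^-1 * sqnorm (y - x)).
  move=> y; apply: (@continuousM R _ (cst _) (fun y => sqnorm (y - x))).
    exact: cst_continuous.
  exact: sqnormB_continuous.
have s0 : sqnorm (x - x) = 0 by rewrite subrr sqnorm0.
have d0 : dot (G x) (x - x) = 0 by rewrite subrr dot0r.
apply: (@squeeze_cvgr _ (nbhs x) _ _ (fun y => W x + dot (G x) (y - x))
  (fun y => W x + dot (G x) (y - x) + (2 * lam)^-1 * sqnorm (y - x))).
- near=> y; rewrite coco_descent andbT.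
  apply: le_trans (coco x y); rewrite lerDl.
  by rewrite mulr_ge0 ?sqnorm_ge0// divr_ge0// ltW.
- rewrite -[X in _ --> X]addr0 -d0; apply: cvgD; [exact: cvg_cst|exact: cd].
- rewrite -[X in _ --> X]addr0 -[X in _ --> X + _]addr0 -[X in _ --> _ + X](mulr0 (2 * lam)^-1) -{1}d0 -s0.
  apply: cvgD; last exact: cq.
  by apply: cvgD; [exact: cvg_cst|exact: cd].
Unshelve. all: by end_near. Qed.

End cocoercive.

(** * Growth of the Moreau envelope *)

Lemma limsup_infty_ratio_lt1 (R : realType) d (f : 'rV[R]_d -> 'rV[R]_d) (l : R) :
  limsup_infty (fun x => enorm (f x) / enorm x) = l%:E -> l < 1 ->
  exists a r : R, [/\ 0 < a, a < 1 &
    forall x, r < sqnorm x -> sqnorm (f x) <= a ^+ 2 * sqnorm x].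
Proof.
move=> hl l1.
(* [(1 + l) / 2] lies strictly between [l] and 1; the maximum with 1/2 makes [a] positive whatever
   the sign of [l]. *)
pose a : R := Num.max 2^-1 ((1 + l) / 2).
have la : l < a by rewrite lt_max; apply/orP; right; lra.
have : (limsup_infty (fun x => enorm (f x) / enorm x)%R < a%:E)%E.
  by rewrite hl lte_fin.
move=> /ereal_inf_lt[_ [M _ <-] hM]; exists a, (M ^+ 2).
have a0 : 0 < a by rewrite lt_max invr_gt0 ltr0n.
split => //; first by rewrite gt_max; apply/andP; split; lra.
move=> x Mx.
have s0 := sqnorm_ge0 x; have sf0 := sqnorm_ge0 (f x).
have sx : 0 < sqnorm x by apply: le_lt_trans Mx; exact: sqr_ge0.
have ex : 0 < enorm x by rewrite sqrtr_gt0.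
have Mex : M < enorm x.
  apply: le_lt_trans (ler_norm M) _.
  by rewrite -sqrtr_sqr ltr_sqrt.
have : (enorm (f x) / enorm x < a)%R.
  rewrite -lte_fin; apply: le_lt_trans hM; apply: ereal_sup_ubound.
  by exists x.
rewrite ltr_pdivrMr// => /ltW h.
rewrite -[sqnorm (f x)]sqr_sqrtr// -[sqnorm x]sqr_sqrtr// -exprMn.
by rewrite ler_pXn2r ?nnegrE ?mulr_ge0 ?sqrtr_ge0 ?(ltW a0).
Qed.

Section growth.
Context {R : realType} {d : nat} (psi : 'rV[R]_d -> \bar R) (lam : R).
Hypothesis psi_proper : proper_fun psi.
Hypothesis psi_closed : closed_fun psi.
Hypothesis psi_convex : convex_fun psi.
Hypothesis lam0 : 0 < lam.
Variable m : R.
Hypothesis psi_ge : forall x, (m%:E <= psi x)%E.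
Variables a r : R.
Hypotheses (a0 : 0 < a) (a1 : a < 1).
Hypothesis prox_le : forall x, r < sqnorm x ->
  sqnorm (prox psi lam x) <= a ^+ 2 * sqnorm x.
Implicit Types x y : 'rV[R]_d.
Notation g := (grad_moreau psi lam).
Notation U := (menv psi lam).

Lemma dot_prox_le x : r < sqnorm x -> dot x (prox psi lam x) <= a * sqnorm x.
Proof.
move=> /prox_le; move: (prox psi lam x) => p h.
have h2 := young a x p; have a2 : 0 < 2 * a by rewrite mulr_gt0.
rewrite -(ler_pM2l a2); lra.
Qed.

Lemma dot_grad_ge x : r < sqnorm x ->
  (1 - a) / lam * sqnorm x <= dot (g x) x.
Proof.
move=> /dot_prox_le h.
rewrite /grad_moreau dotZl !dotE -sqnormE (dotC _ x).
rewrite mulrAC mulrC ler_pM2l ?invr_gt0//; lra.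
Qed.

(** The reverse triangle inequality [|x - p| >= (1 - a) |x|] in squared form: [|p - a x|^2 >= 0]
    bounds [|p|^2] below by a linear function of [<x, p>], and [<x, p> <= a |x|^2] does the rest. *)
Lemma sqnorm_grad_ge x : r < sqnorm x ->
  ((1 - a) / lam) ^+ 2 * sqnorm x <= sqnorm (g x).
Proof.
move=> rx; have := dot_prox_le rx; have := prox_le rx.
rewrite /grad_moreau; move: (prox psi lam x) => p h1 h2.
rewrite sqnormZ sqnormB exprMn -mulrA mulrCA ler_pM2l ?exprn_gt0 ?invr_gt0//.
have := sqnorm_ge0 (p - a *: x); rewrite sqnormB sqnormZ dotZr (dotC p x) => h3.
have s0 := sqnorm_ge0 x.
have : 0 <= (1 - a) * (a * sqnorm x - dot x p) by rewrite mulr_ge0// subr_ge0// ltW.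
lra.
Qed.

Lemma menv_le x :
  U x <= U 0 + sqnorm (g 0) / 2 + (2^-1 + (2 * lam)^-1) * sqnorm x.
Proof.
have := coco_descent lam0
  (menv_cocoercive psi_proper psi_closed psi_convex lam0 psi_ge) 0 x.
rewrite subr0; have := young 1 (g 0) x; move: (g 0) (U 0) (U x) => v u w; lra.
Qed.

(** Co-coercivity between the midpoint [y = x / 2] and [x] gives [U x >= U y + <g y, y>] since
    [x - y = y], and the inner product grows like [|y|^2]. One such step replaces an integration
    along the ray. For small [y] the bound [m] suffices, at the price of the constant [b2]. *)
Lemma menv_quadratic_ge : exists b1 b2 : R, 0 < b1 /\
  forall x, b1 * sqnorm x - b2 <= U x.
Proof.
pose b := (1 - a) / lam; have b0 : 0 < b by rewrite divr_gt0// subr_gt0.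
exists (b / 4), (Num.max 0 (b * r) - m); split => [|x].
  by rewrite divr_gt0.
have Um := menv_ge psi_proper psi_closed lam0 psi_ge.
pose y := 2^-1 *: x.
have yx : sqnorm x = 4 * sqnorm y by rewrite sqnormZ; field.
have [ry|ry] := leP (sqnorm y) r.
  apply: le_trans (Um x).
  have h : b * sqnorm y <= b * r by rewrite ler_pM2l.
  have : b * sqnorm y <= Num.max 0 (b * r) by rewrite le_max h orbT.
  rewrite yx; move: (Num.max _ _) => t; lra.
have h1 := menv_cocoercive psi_proper psi_closed psi_convex lam0 psi_ge y x.
have h2 := dot_grad_ge ry.
have e : x - y = y by rewrite -{1}(scale1r x) -scalerBl; congr (_ *: _); lra.
rewrite e in h1; have h3 := Um y.
have h4 : 0 <= lam / 2 * sqnorm (g x - g y).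
  by rewrite mulr_ge0 ?sqnorm_ge0// divr_ge0// ltW.
have h5 : 0 <= Num.max 0 (b * r) by rewrite le_max lexx.
rewrite yx; move: h1 h2 h4 h5; rewrite -/b.
move: (Num.max _ _) (lam / 2 * _) (dot _ _) => t p q; lra.
Qed.

(** Far out, [|g x|^2] is at least a multiple of [|x|^2], while [U x] is at most a quadratic in
    [|x|]; eliminate [|x|^2]. The constant [c2] makes the left side nonpositive on the ball
    [sqnorm x <= r]. *)
Lemma sqnorm_grad_ge_menv : exists c1 c2 : R, 0 < c1 /\
  forall x, c1 * (U x - m) - c2 <= sqnorm (g x).
Proof.
pose b := ((1 - a) / lam) ^+ 2.
have b0 : 0 < b by rewrite exprn_gt0// divr_gt0// subr_gt0.
pose A1 := U 0 + sqnorm (g 0) / 2 - m.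
pose A2 := 2^-1 + (2 * lam)^-1.
have A20 : 0 < A2 by rewrite addr_gt0// invr_gt0// mulr_gt0.
exists (b / A2), (b / A2 * (A1 + A2 * Num.max 0 r)).
have c0 : 0 < b / A2 by rewrite divr_gt0.
split => // x.
rewrite -mulrBr.
have h : U x - m <= A1 + A2 * sqnorm x.
  by have := menv_le x; rewrite /A1 -/A2; move: (U x) (U 0) => u v; lra.
have [rx|rx] := leP (sqnorm x) r.
  apply: (@le_trans _ _ 0); last exact: sqnorm_ge0.
  rewrite pmulr_rle0// subr_le0; apply: (le_trans h).
  by rewrite lerD2l ler_pM2l// le_max rx orbT.
apply: le_trans (sqnorm_grad_ge rx).
rewrite -/b -mulrA ler_pM2l// ler_pdivrMl//.
have : 0 <= A2 * Num.max 0 r by rewrite mulr_ge0 ?le_max ?lexx// ltW.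
move: (A2 * Num.max _ _) (U x) h => t u; lra.
Qed.

End growth.

(** * Leapfrog integrator *)

Section leapfrog.
Context {R : realType} {d : nat}.
Notation V := 'rV[R]_d.
Implicit Types (x z : V) (w : V * V).
Variables (W : V -> R) (G : V -> V) (eps : R).

(** The leapfrog step with the gradient as a parameter. At [G = grad_moreau psi lam] it is
    convertible to [leapfrog1]. *)
Definition lf1 w : V * V :=
  let z1 := w.2 - (eps / 2) *: G w.1 in
  let x1 := w.1 + eps *: z1 in
  (x1, z1 - (eps / 2) *: G x1).

Definition lf L w : V * V := iter L lf1 w.

Definition ham w : R := W w.1 + sqnorm w.2 / 2.

Definition acc L w : R := Num.min 1 (expR (- ham (lf L w) + ham w)).

Definition flip w : V * V := (w.1, - w.2).

Lemma flipK : involutive flip.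
Proof. by case=> x z; rewrite /flip opprK. Qed.

Lemma lf1_reversible w : flip (lf1 (flip (lf1 w))) = w.
Proof.
case: w => x z; rewrite /flip /lf1 /=; set x1 := x + _.
set z1 := z - _ - _ *: G x1.
have -> : x1 + eps *: (- z1 - (eps / 2) *: G x1) = x.
  rewrite /z1; move: (G x1) => b; rewrite /x1; move: (G x) => a.
  by apply/rowP => i; rewrite !mxE; ring.
congr pair; rewrite /z1; move: (G x1) (G x) => b a.
by apply/rowP => i; rewrite !mxE; ring.
Qed.

(** Conjugation by the flip inverts a step, so the last step of the forward trajectory cancels
    against the first step of the reversed one. *)
Lemma flip_lfK L : involutive (flip \o lf L).
Proof.
rewrite /lf; elim: L => [|L IH] w; first exact: flipK.
rewrite /= -iterS iterSr.
have -> : lf1 (flip (lf1 (iter L lf1 w))) = flip (iter L lf1 w).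
  by rewrite -[LHS]flipK lf1_reversible.
exact: IH.
Qed.

Lemma ham_flip w : ham (flip w) = ham w.
Proof. by rewrite /ham /flip /= sqnormN. Qed.

Lemma acc_ge0 L w : 0 <= acc L w.
Proof. by rewrite /acc le_min ler01 expR_ge0. Qed.

Lemma acc_le1 L w : acc L w <= 1.
Proof. by rewrite /acc ge_min lexx. Qed.

(** Dropping the final kinetic energy, which is nonnegative, bounds the acceptance probability by
    the exponential of minus the increase of [W] beyond [|z|^2 / 2]. Large increases are thus
    rejected often enough. *)
Lemma acc_increase L w :
  acc L w * (W (lf L w).1 - W w.1) <= sqnorm w.2 / 2 + 1.
Proof.
have a0 := acc_ge0 L w; have a1 := acc_le1 L w.
have : acc L w <= expR (- (W (lf L w).1 - W w.1 - sqnorm w.2 / 2)).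
  rewrite /acc ge_min; apply/orP; right.
  rewrite ler_expR /ham; have := sqnorm_ge0 (lf L w).2.
  by move: (sqnorm _) (sqnorm _) => p q; lra.
move: a0 a1 (sqnorm_ge0 w.2); move: (acc _ _) (sqnorm w.2) (W _ - _) => a s t.
move=> a0 a1 s0 h.
(* [u * expR (- u) <= 1] for the excess [u = t - s / 2] *)
have e0 : a * (t - s / 2) <= 1.
  have [ts|ts] := leP (t - s / 2) 0.
    by apply: le_trans ler01; rewrite mulr_ge0_le0.
  apply: (@le_trans _ _ (expR (- (t - s / 2)) * (t - s / 2))).
    by rewrite ler_wpM2r// ltW.
  rewrite expRN mulrC ler_pdivrMr ?expR_gt0// mul1r.
  by apply: le_trans (expR_ge1Dx _); rewrite lerDr.
have : a * (s / 2) <= s / 2 by rewrite ler_piMl// divr_ge0.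
lra.
Qed.

Variable lam : R.
Hypothesis lam0 : 0 < lam.
Hypothesis coco : cocoercive lam W G.
Hypothesis eps0 : 0 < eps.
Hypothesis eps_lam : eps ^+ 2 <= 2 * lam.

(* The energy error of one step is at most
   (eps/2) <z, h> + (eps^2/8 - lam/2) |h|^2 where h is the gradient increment:
   co-coercivity dominates the error of the trapezoidal rule. *)
Lemma lf1_energy w : ham (lf1 w) - ham w <= sqnorm w.2 / 2.
Proof.
case: w => x z; rewrite /lf1 /ham /=; set x1 := x + _.
have := coco x1 x.
have -> : x - x1 = - (eps *: (z - (eps / 2) *: G x)).
  by rewrite /x1 opprD addrA subrr add0r.
move: (G x) (G x1) (W x) (W x1) => a b u v {x1} h1.
(* This splits the cross term into [|z|^2 / 2] and [eps^2 / 8 |h|^2]. The total coefficient of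
   [|h|^2] becomes [eps^2 / 4 - lam / 2], nonpositive exactly when [eps^2 <= 2 lam]. *)
have h2 := young (eps / 2) (a - b) (- z).
have h3 : 0 <= (2 * lam - eps ^+ 2) * sqnorm (a - b).
  by rewrite mulr_ge0 ?sqnorm_ge0// subr_ge0.
move: h1 h2 h3; rewrite !sqnormE !dotE (dotC b a) (dotC a z) (dotC b z).
lra.
Qed.

Lemma acc1_ge w : expR (- (sqnorm w.2 / 2)) <= acc 1 w.
Proof.
rewrite /acc le_min; apply/andP; split.
  by rewrite -expR0 ler_expR oppr_le0 divr_ge0 ?sqnorm_ge0.
rewrite ler_expR; have := lf1_energy w; rewrite /lf /=.
by move: (ham _) (ham w) => p q; lra.
Qed.

(** The displacement is [eps v] with [v = z - (eps / 2) G x]. In the descent inequality the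
    step-size condition bounds the quadratic term by [|v|^2], and then the two cross terms
    [eps <G x, z>] cancel. *)
Lemma lf1_descent w :
  W (lf1 w).1 <= W w.1 - eps ^+ 2 / 4 * sqnorm (G w.1) + sqnorm w.2.
Proof.
case: w => x z; rewrite /lf1 /=; set x1 := x + _.
have := coco_descent lam0 coco x x1.
have -> : x1 - x = eps *: (z - (eps / 2) *: G x).
  by rewrite /x1 addrAC subrr add0r.
move: (G x) (W x) (W x1) => a u v {x1} h.
have : (2 * lam)^-1 * sqnorm (eps *: (z - (eps / 2) *: a))
    <= sqnorm (z - (eps / 2) *: a).
  rewrite sqnormZ mulrA ler_piMl ?sqnorm_ge0//.
  by rewrite ler_pdivrMl ?mulr_gt0// mulr1.
move: h; set q := (2 * lam)^-1 * _; move: q => q.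
rewrite !sqnormE !dotE (dotC a z); lra.
Qed.

End leapfrog.

(** * Harris' theorem *)

Section harris.
Context {d} {T : measurableType d} {R : realType}.
Variable P : (T -> \bar R) -> T -> \bar R.
Implicit Types f g : T -> \bar R.

Hypothesis measurable_P : forall f, measurable_fun setT f ->
  (forall x, 0 <= f x)%E -> measurable_fun setT (P f).
Hypothesis P_ge0 : forall f, (forall x, 0 <= f x)%E -> forall x, (0 <= P f x)%E.
Hypothesis PD : forall f g, measurable_fun setT f -> measurable_fun setT g ->
  (forall x, 0 <= f x)%E -> (forall x, 0 <= g x)%E ->
  forall x, P (fun y => f y + g y)%E x = (P f x + P g x)%E.
Hypothesis PZ : forall (c : R) f, 0 <= c -> measurable_fun setT f ->
  (forall x, 0 <= f x)%E -> forall x, P (fun y => c%:E * f y)%E x = (c%:E * P f x)%E.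
Hypothesis P_cst : forall (c : R), 0 <= c -> forall x, P (cst c%:E) x = c%:E.
Hypothesis P_le : forall f g, measurable_fun setT f -> measurable_fun setT g ->
  (forall x, 0 <= f x)%E -> (forall x, f x <= g x)%E -> forall x, (P f x <= P g x)%E.

Variable V : T -> R.
Hypothesis measurable_V : measurable_fun setT V.
Hypothesis V_ge0 : forall x, 0 <= V x.
Variables gam K : R.
Hypothesis gam_lt1 : gam < 1.
Hypothesis K_ge0 : 0 <= K.
Hypothesis drift : forall x, (P (EFin \o V) x <= (gam * V x + K)%:E)%E.

Let Q (f : T -> R) x : R := fine (P (EFin \o f) x).

Let PQ (f : T -> R) : measurable_fun setT f -> (forall x, 0 <= f x <= 1) ->
  [/\ P (EFin \o f) = EFin \o Q f, measurable_fun setT (Q f) &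
      forall x, 0 <= Q f x <= 1].
Proof.
move=> mf f01.
have f0 x : (0 <= (EFin \o f) x)%E by rewrite lee_fin; case/andP: (f01 x).
have mEf : measurable_fun setT (EFin \o f) by exact/measurable_EFinP.
have Pf0 x : (0 <= P (EFin \o f) x)%E by exact: P_ge0.
have Pf1 x : (P (EFin \o f) x <= 1%:E)%E.
  rewrite -(P_cst ler01 x); apply: P_le => // y.
  by rewrite lee_fin; case/andP: (f01 y).
have PE x : P (EFin \o f) x = (Q f x)%:E.
  by rewrite fineK// ge0_fin_numE// (le_lt_trans (Pf1 x))// ltry.
split.
- exact/funext.
- apply/measurable_EFinP; rewrite (_ : EFin \o _ = P (EFin \o f)); last exact/funext.
  exact: measurable_P.
- by move=> x; rewrite -!lee_fin -PE Pf0 Pf1.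
Qed.

Let v x : R := fine (P (EFin \o V) x).

Let PV x : P (EFin \o V) x = (v x)%:E.
Proof.
rewrite fineK// ge0_fin_numE; last by apply: P_ge0 => y; rewrite lee_fin.
by rewrite (le_lt_trans (drift x))// ltry.
Qed.

Let vle x : v x <= gam * V x + K.
Proof. by rewrite -lee_fin -PV. Qed.

Let mEFin (f : T -> R) : measurable_fun setT f -> measurable_fun setT (EFin \o f).
Proof. by move=> mf; exact/measurable_EFinP. Qed.

Let PDr (f g h : T -> R) x : measurable_fun setT f -> measurable_fun setT g ->
  (forall y, 0 <= f y) -> (forall y, 0 <= g y) -> (forall y, h y = f y + g y) ->
  P (EFin \o h) x = (P (EFin \o f) x + P (EFin \o g) x)%E.
Proof.
move=> mf mg f0 g0 hE; rewrite -PD//; [|exact: mEFin|exact: mEFin].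
by congr (P _ x); apply/funext => y; rewrite /= hE EFinD.
Qed.

Let P_lin (t s : R) x : 0 <= t -> 0 <= s ->
  P (EFin \o (fun y => s + t * V y)) x = (s + t * v x)%:E.
Proof.
move=> t0 s0.
rewrite (PDr (f := cst s) (g := fun y => t * V y))//; last 2 first.
- exact: measurable_funM.
- by move=> y; rewrite mulr_ge0.
by rewrite P_cst// EFinD EFinM -PV -PZ//; exact: mEFin.
Qed.

(** Minorization by duality: for Markov kernels the infimum of [P f x + P g y] over [f + g >= 1] is
    the mass common to [P(x, .)] and [P(y, .)]. No minorizing measure has to be named, and the
    contraction estimate uses precisely this form. *)
Definition minorizes (a r : R) := forall f g (t : R),
  measurable_fun setT f -> measurable_fun setT g ->
  (forall x, 0 <= f x)%E -> (forall x, 0 <= g x)%E ->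
  0 <= t -> (forall x, t%:E <= f x + g x)%E ->
  forall x y, V x + V y <= r -> ((a * t)%:E <= P f x + P g y)%E.

(* Hairer-Mattingly contraction for the seminorm
   sup_{x,y} |f x - f y| / (2 + b V x + b V y). *)
Let osc (b th : R) (f : T -> R) :=
  forall x y, f x - f y <= th * (2 + b * V x + b * V y).

(** For a centre [c] with [|f - c| <= th (1 + b V)], the functions [h] and [k] below are nonnegative
    with [h + k >= 2 th], and [Q f x - Q f y] equals [th (2 + b v x + b v y)] minus [P h x + P k y].
    Positivity of [P] handles distant pairs, minorization the others. *)
Let osc_step (a b r th : R) (f : T -> R) :
  0 <= b -> minorizes a r -> 0 <= th ->
  measurable_fun setT f -> (forall x, 0 <= f x <= 1) -> osc b th f ->
  forall x y, Q f x - Q f y <= th * (2 + b * v x + b * v y) -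
    (if V x + V y <= r then 2 * a * th else 0).
Proof.
move=> b_ge0 minor th0 mf f01 of_ x y.
have [PE mQ Q01] := PQ mf f01.
pose S := [set f u - th * (1 + b * V u) | u in setT].
have W0 u : 0 <= th * (1 + b * V u) by rewrite mulr_ge0// addr_ge0// mulr_ge0.
have S1 : ubound S 1.
  move=> _ [u _ <-]; have := W0 u; have /andP[_] := f01 u.
  by move: (f u) (th * _) => p q; lra.
have S0 : has_sup S.
  by split; [exists (f x - th * (1 + b * V x)), x|exists 1].
(* The oscillation bound says that every [f u - th (1 + b V u)] lies below every
   [f w + th (1 + b V w)]; their supremum is therefore the required centre. *)
pose c := sup S.
have c_ge u : f u - th * (1 + b * V u) <= c.
  by apply: sup_upper_bound => //; exists u.
have c_le u : c <= f u + th * (1 + b * V u).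
  apply: sup_le_ub; first by case: S0.
  move=> _ [w _ <-]; have := of_ w u.
  by move: (f w) (f u) => p q; lra.
pose h u := c + th * (1 + b * V u) - f u.
pose k u := f u - c + th * (1 + b * V u).
have h0 u : 0 <= h u by have := c_ge u; rewrite /h; move: (f u) (th * _) => p q; lra.
have k0 u : 0 <= k u by have := c_le u; rewrite /k; move: (f u) (th * _) => p q; lra.
have mW : measurable_fun setT (fun u => th * (1 + b * V u)).
  by do !apply: measurable_funM => //; apply: measurable_funD => //; exact: measurable_funM.
have mh : measurable_fun setT h.
  by apply: measurable_funB => //; exact: measurable_funD.
have mk : measurable_fun setT k.
  by apply: measurable_funD => //; exact: measurable_funB.
(* [P] is additive on nonnegative functions only, so the centre, of unknown sign, is split into its
   positive and negative parts, which are placed on opposite sides. *)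
pose cp := Num.max c 0; pose cn := Num.max (- c) 0.
have cp0 : 0 <= cp by rewrite le_max lexx orbT.
have cn0 : 0 <= cn by rewrite le_max lexx orbT.
have cE : c = cp - cn.
  by rewrite /cp /cn; have [c0|c0] := leP c 0; [rewrite max_l|rewrite max_r]; lra.
have f0 u : (0 <= (EFin \o f) u)%E by rewrite lee_fin; case/andP: (f01 u).
have thb : 0 <= th * b by rewrite mulr_ge0.
have mfc (s : R) : measurable_fun setT (fun u => f u + s) by exact: measurable_funD.
have Qfc (s : R) u : 0 <= s -> P (EFin \o (fun u => f u + s)) u = (Q f u + s)%:E.
  move=> s0; rewrite (PDr (f := f) (g := cst s))// ?PE ?P_cst//.
have Ph u : P (EFin \o h) u = (c + th * (1 + b * v u) - Q f u)%:E.
  have : (P (EFin \o h) u + (Q f u + cn)%:E = (cp + th + th * b * v u)%:E)%E.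
    rewrite -P_lin ?addr_ge0// -Qfc//; apply/esym/PDr => // w.
      by rewrite addr_ge0//; case/andP: (f01 w).
    by rewrite /h cE; move: (f w) (V w) => p q; lra.
  case: (P _ _) => // r0 [] e; congr EFin; rewrite cE.
  by move: e; move: (Q f u) (v u) => p q; lra.
have Pk u : P (EFin \o k) u = (Q f u - c + th * (1 + b * v u))%:E.
  have : (P (EFin \o k) u + cp%:E = (Q f u + (cn + th) + th * b * v u)%:E)%E.
    rewrite -(P_cst cp0 u).
    rewrite -(PDr (h := fun w => (f w + cn) + (th + th * b * V w)))//; last first.
      by move=> w; rewrite /k cE; move: (f w) (V w) => p q; lra.
    rewrite (PDr (f := fun w => f w + cn) (g := fun w => th + th * b * V w))//.
    - by rewrite Qfc// P_lin// -EFinD; congr EFin; lra.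
    - by apply: measurable_funD => //; exact: measurable_funM.
    - by move=> w; rewrite addr_ge0//; case/andP: (f01 w).
    - by move=> w; rewrite addr_ge0// mulr_ge0.
  case: (P _ _) => // r0 [] e; congr EFin; rewrite cE.
  by move: e; move: (Q f u) (v u) => p q; lra.
case: ifPn => [xyR|_]; last first.
  have : (0 <= P (EFin \o h) x)%E by apply: P_ge0 => u; rewrite lee_fin.
  have : (0 <= P (EFin \o k) y)%E by apply: P_ge0 => u; rewrite lee_fin.
  by rewrite Ph Pk !lee_fin; move: (Q f x) (Q f y) (v x) (v y) => p q p' q'; lra.
have := minor (EFin \o h) (EFin \o k) (2 * th) (mEFin mh) (mEFin mk) _ _ _ _ x y xyR.
rewrite Ph Pk -EFinD lee_fin.
move=> /(_ _ _ _ _)-H; have {H} := H ltac:(by move=> u; rewrite lee_fin)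
  ltac:(by move=> u; rewrite lee_fin) ltac:(by rewrite mulr_ge0).
have hk u : ((2 * th)%:E <= (EFin \o h) u + (EFin \o k) u)%E.
  rewrite lee_fin /h /k; have : 0 <= th * (b * V u) by rewrite !mulr_ge0.
  by move: (f u) (b * V u) => p q; lra.
move=> /(_ hk); move: (Q f x) (Q f y) (v x) (v y) => p q p' q'; lra.
Qed.

Hypothesis minor : forall r, exists2 a, 0 < a & minorizes a r.

Lemma harris : exists rho b : R, [/\ 0 <= rho, rho < 1, 0 <= b &
  forall (f : T -> R) n, measurable_fun setT f -> (forall x, 0 <= f x <= 1) ->
  exists fn : T -> R, [/\ iter n P (EFin \o f) = EFin \o fn,
    measurable_fun setT fn, (forall x, 0 <= fn x <= 1) &
    forall x y, fn x - fn y <= rho ^+ n * (2 + b * V x + b * V y)]].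
Proof.
(* For pairs with [V x + V y >= r] the drift gains at least [4 b (K + 1)]. Half of that covers
   [2 b K + 2 eta], as [eta <= b]; the other half covers the loss from [eta <= (1 - gam) / 2]. *)
pose r := 4 * (K + 1) / (1 - gam).
have [a' a'0 mina'] := minor r.
(* Capping at 1 forces [eta <= 1 / 2], so that the rate [1 - eta] is nonnegative. *)
pose a := Num.min 1 a'.
have a0 : 0 < a by rewrite lt_min ltr01.
have a1 : a <= 1 by rewrite ge_min lexx.
have mina : minorizes a r.
  move=> f g t mf mg f0 g0 t0 fg x y xyr.
  apply: le_trans (mina' f g t mf mg f0 g0 t0 fg x y xyr).
  by rewrite lee_fin ler_wpM2r// ge_min lexx orbT.
(* The weight makes [2 b K <= a]: for close pairs the minorization gain [2 a] pays for the drift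
   constant and leaves [a >= 2 eta]. *)
pose b := a / (2 * (K + 1)).
have K1 : 0 < 2 * (K + 1) by rewrite mulr_gt0// ltr_wpDl.
have b0 : 0 < b by rewrite divr_gt0.
have bE : b * (K + 1) = a / 2.
  by rewrite /b; field; rewrite gt_eqF// ltr_wpDl.
have g1 : 0 < 1 - gam by rewrite subr_gt0.
pose eta := Num.min b (Num.min ((1 - gam) / 2) (a / 2)).
have eta0 : 0 < eta by rewrite !lt_min b0 !divr_gt0.
have eta_b : eta <= b by rewrite ge_min lexx.
have eta_g : eta <= (1 - gam) / 2 by rewrite !ge_min lexx !orbT.
have eta_a : eta <= a / 2 by rewrite !ge_min lexx !orbT.
have rE : r * (1 - gam) = 4 * (K + 1) by rewrite /r divfK// gt_eqF.
clearbody eta b a r.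
exists (1 - eta), b; split; [lra|lra|exact: ltW|].
move=> f n mf f01; elim: n => [|n [fn [fE mfn fn01 oscn]]].
  exists f; split => // x y; rewrite expr0 mul1r.
  have /andP[h1 h2] := f01 x; have /andP[h3 h4] := f01 y.
  have : 0 <= b * V x by rewrite mulr_ge0// ltW.
  have : 0 <= b * V y by rewrite mulr_ge0// ltW.
  lra.
have [PE mQ Q01] := PQ mfn fn01.
exists (Q fn); split => //; first by rewrite iterS fE.
move=> x y.
have th0 : 0 <= (1 - eta) ^+ n by rewrite exprn_ge0//; lra.
apply: le_trans (osc_step (ltW b0) mina th0 mfn fn01 oscn x y) _.
rewrite exprSr; move: ((1 - eta) ^+ n) th0 => th th0.
have [S SE] : exists S, S = V x + V y by exists (V x + V y).
have S0 : 0 <= S by rewrite SE addr_ge0.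
have h1 : b * (v x + v y) <= b * (gam * S + 2 * K).
  by rewrite ler_pM2l// SE; have := vle x; have := vle y; lra.
have h2 : 0 <= b * (1 - gam - eta) * S.
  apply: mulr_ge0 => //; apply: mulr_ge0; first exact: ltW.
  lra.
suff h : 2 + b * (v x + v y) - (if V x + V y <= r then 2 * a else 0)
    <= (1 - eta) * (2 + b * S).
  have := ler_wpM2l th0 h; rewrite SE; case: ifP => _.
    by move: (v x) (v y) => p q; lra.
  by move: (v x) (v y) => p q; lra.
rewrite -SE; case: ifPn => [Sr|].
  by move: h1 h2; move: (v x + v y) => w h1 h2; lra.
rewrite -ltNge => /ltW rS.
have h3 : b * (r * (1 - gam)) <= b * (S * (1 - gam)).
  by rewrite ler_pM2l// ler_pM2r.
have h4 : 0 <= b * ((1 - gam) / 2 - eta) * S.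
  apply: mulr_ge0 => //; apply: mulr_ge0; first exact: ltW.
  by rewrite subr_ge0.
rewrite rE in h3.
have bK : b * K = a / 2 - b by rewrite -bE; ring.
move: h1 h2 h3 h4; move: (v x + v y) => w h1 h2 h3 h4; lra.
Qed.

End harris.

(** * Borel sets and Lebesgue measure on row vectors *)

Fact mx_display : measure_display.
Proof. exact: default_measure_display. Qed.

(** Generated by the open sets, so that measurability of a set of row vectors unfolds to
    [borelRd]. *)
HB.instance Definition _ (R : realType) (m n : nat) :=
  @isMeasurable.Build mx_display 'M[R]_(m, n)
    <<s @open 'M[R]_(m, n) >> (@sigma_algebra0 _ setT _)
    (@sigma_algebraC _ _) (@sigma_algebra_bigcup _ setT _).

Section borel.
Context {R : realType}.

Lemma continuous_measurable_mx m n (f : 'M[R]_(m, n) -> R) :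
  continuous f -> measurable_fun setT f.
Proof.
move=> /continuousP cf; apply: (measurability _ (RGenOpens.measurableE R)).
move=> _ [_ [a [b ->] <-]]; rewrite setTI; apply: sub_sigma_algebra.
by apply: cf; exact: interval_open.
Qed.

Lemma measurable_coord m n i j :
  measurable_fun setT (fun M : 'M[R]_(m, n) => M i j).
Proof. by apply: continuous_measurable_mx; exact: coord_continuous. Qed.

(** Second countability: the balls with rational centre and radius [1 / (k + 1)] contained in [A]
    cover it, and pairs of centre and index are enumerated by [pickle]. *)
Lemma open_bigcup_ball m n (A : set 'M[R]_(m, n)) : open A ->
  exists (c : nat -> 'M[R]_(m, n)) (r : nat -> R),
  A = \bigcup_k ball (c k) (r k).
Proof.
move=> oA.
pose b (p : 'M[rat]_(m, n) * nat) : set 'M[R]_(m, n) :=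
  ball (\matrix_(i, j) ratr (p.1 i j) : 'M[R]_(m, n)) (p.2.+1%:R^-1).
pose D (k : nat) p := unpickle k = Some p /\ b p `<=` A.
pose g k := get (D k).
exists (fun k => \matrix_(i, j) ratr ((g k).1 i j)).
(* Codes of no admissible ball receive radius 0, hence the empty ball. *)
exists (fun k => if pselect (exists p, D k p) then (g k).2.+1%:R^-1 else 0).
apply/seteqP; split => [x Ax|x [k _]]; last first.
  rewrite /=; case: pselect => /= [e1|_ [] //]; last by rewrite ltxx.
  by have [_ h] := getPex e1; exact: h.
have /nbhs_ballP[e /= e0 eA] : nbhs x A by exact: open_nbhs_nbhs.
(* Radius below [e / 2]: a ball of radius [r] that contains [x] then lies in the ball of radius [e]
   about [x]. *)
have [k [r [rE r0 re]]] : exists k r, [/\ r = k.+1%:R^-1, 0 < r & r < e / 2].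
  have [|k hk] := @ltr_add_invr R 0 (e/2); first by rewrite divr_gt0.
  by exists k, (k.+1%:R^-1); rewrite invr_gt0; rewrite add0r in hk.
have /choice [q hq] : forall ij : 'I_m * 'I_n, exists q : rat,
    ball (x ij.1 ij.2) r (ratr q : R).
  move=> ij.
  have [|q] := @rat_in_itvoo R (x ij.1 ij.2 - r) (x ij.1 ij.2 + r).
    by lra.
  rewrite in_itv /= => /andP[h1 h2]; exists q.
  by rewrite /ball /= ltr_norml; apply/andP; split; lra.
pose p := (\matrix_(i, j) q (i, j), k).
have bx : b p x.
  rewrite /b -rE; split => // i j; rewrite !mxE; apply: ball_sym.
  exact: (hq (i, j)).
have Dp : D (pickle p) p.
  split; first by rewrite pickleK.
  rewrite /b -rE => y [_ hy]; apply: eA; split => // i j.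
  have h2 := hy i j; rewrite !mxE in h2.
  have := ball_triangle (hq (i, j)) h2; apply: le_ball.
  by lra.
exists (pickle p) => //.
case: pselect => [e1|]; last by case; exists p.
have [+ _] := getPex e1; rewrite -/(g _) pickleK => -[<-].
exact: bx.
Qed.

(** Open sets are countable unions of balls, and a ball for the sup distance is a finite
    intersection of conditions on single entries. *)
Lemma measurable_mx d (T : measurableType d) m n (h : T -> 'M[R]_(m, n)) :
  (forall i j, measurable_fun setT (fun t => h t i j)) ->
  measurable_fun setT h.
Proof.
move=> mh; apply: (@measurability _ _ _ 'M[R]_(m, n) _ _ (@open 'M[R]_(m, n))) => //.
move=> _ [A oA <-].
rewrite setTI; have [c [r ->]] := open_bigcup_ball oA.
rewrite preimage_bigcup; apply: bigcupT_measurable => k.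
have [r0|r0] := leP (r k) 0.
  rewrite (_ : _ @^-1` _ = set0) //; apply/seteqP; split => // t /= [].
  by rewrite ltNge r0.
rewrite (_ : _ @^-1` _ = \big[setI/setT]_(ij : 'I_m * 'I_n)
    ((fun t => h t ij.1 ij.2) @^-1` ball (c k ij.1 ij.2) (r k))).
  apply: bigsetI_measurable => -[i j] _ /=.
  by rewrite -[X in measurable X]setTI; apply: mh => //; exact: measurable_ball.
apply/seteqP; split => [t [_ ht]|t].
  by elim/big_rec: _ => // ij X _ tX; split => //; exact: ht.
move=> ht; split => // i j.
by move: ht; rewrite (bigD1 (i, j))//= => -[].
Qed.

End borel.

(** An image measure may fail to be sigma-finite; the left inverse [psi] carries an exhausting
    sequence of [X] over to [Y]. *)
Lemma sigma_finite_transfer d1 d2 (X : measurableType d1)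
    (Y : measurableType d2) (R : realType)
    (m : {measure set X -> \bar R}) (phi : X -> Y) (psi : Y -> X) :
  sigma_finite setT m ->
  measurable_fun setT phi -> measurable_fun setT psi -> cancel phi psi ->
  exists nu : {sigma_finite_measure set Y -> \bar R},
    (nu : set Y -> \bar R) = pushforward m phi.
Proof.
move=> [F FT Foo] mphi mpsi phiK.
pose nu : {measure set Y -> \bar R} :=
  measure_function_pushforward__canonical__measure_function_Measure m mphi.
have snu : sigma_finite setT nu.
  exists (fun i => psi @^-1` F i).
    by rewrite -preimage_bigcup -FT preimage_setT.
  move=> i; have [mF Fo] := Foo i; split.
    by rewrite -[X in measurable X]setTI; exact: mpsi.
  rewrite /nu /= /pushforward -comp_preimage (_ : psi \o phi = id) ?preimage_id//.
  by apply/funext => x /=; rewrite phiK.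
pose J := Measure_isSigmaFinite.Build _ Y R nu snu.
pose nu' : {sigma_finite_measure set Y -> \bar R} :=
  HB.pack (nu : set Y -> \bar R) nu J.
by exists nu'.
Qed.

Lemma sigma_finite_prod d1 d2 (X : measurableType d1) (Y : measurableType d2)
    (R : realType) (m1 : {sigma_finite_measure set X -> \bar R})
    (m2 : {sigma_finite_measure set Y -> \bar R}) :
  sigma_finite setT (m1 \x m2)%E.
Proof.
have [F FT Foo] := sigma_finiteT m1; have [G GT Goo] := sigma_finiteT m2.
pose H n := if unpickle n is Some (i, j) then F i `*` G j else set0.
exists H.
  apply/esym/seteqP; split => // -[x y] _.
  have : [set: X] x by []. rewrite FT => -[i _ Fx].
  have : [set: Y] y by []. rewrite GT => -[j _ Gy].
  by exists (pickle (i, j)) => //; rewrite /H pickleK.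
move=> n; rewrite /H; case: unpickle => [[i j]|]; last by rewrite measure0.
have [mF Fo] := Foo i; have [mG Go] := Goo j; split; first exact: measurableX.
by rewrite product_measure1E// lte_mul_pinfty// ge0_fin_numE.
Qed.

Section lebesgue_rV.
Context {R : realType}.

(** Prepends the coordinate, in the same block form as the recursion of [intRn]. *)
Definition rcons_rV n (p : R * 'rV[R]_n) : 'rV[R]_n.+1 :=
  row_mx (p.1%:M : 'rV[R]_1) p.2.

Definition runcons_rV n (x : 'rV[R]_n.+1) : R * 'rV[R]_n :=
  (x ord0 ord0, \row_i x ord0 (lift ord0 i)).

Lemma rcons_rVK n : cancel (@rcons_rV n) (@runcons_rV n).
Proof.
move=> [t v]; rewrite /rcons_rV /runcons_rV; congr pair.
  by rewrite mxE; case: splitP => // j _; rewrite !ord1 mxE eqxx mulr1n.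
apply/rowP => i; rewrite !mxE; case: splitP => j /=.
  by move=> h; have := ltn_ord j; rewrite -h.
by rewrite /bump /= !add1n => -[h]; congr (v _ _); apply/val_inj.
Qed.

Lemma measurable_rcons_rV n : measurable_fun (setT : set (measurableTypeR R * 'rV[R]_n)%type) (@rcons_rV n).
Proof.
apply: measurable_mx => i j.
case: (split_ordP (j : 'I_(1 + n))) => k jE.
  rewrite (_ : (fun t => _) = fst) //; apply/funext => -[t v] /=.
  rewrite jE; apply: etrans (row_mxEl _ _ i k) _.
  by rewrite !ord1 mxE eqxx mulr1n.
rewrite (_ : (fun t => _) = (fun v : 'rV_n => v i k) \o snd).
  by apply: measurableT_comp => //; exact: measurable_coord.
by apply/funext => -[t v] /=; rewrite jE; exact: row_mxEr.
Qed.

Lemma measurable_runcons_rV n :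
  measurable_fun setT
    (@runcons_rV n : 'rV[R]_n.+1 -> (measurableTypeR R * 'rV[R]_n)%type).
Proof.
apply/measurable_fun_pairP; split; first exact: measurable_coord.
apply: measurable_mx => i j.
rewrite (_ : (fun t => _) = fun x : 'rV[R]_n.+1 => x ord0 (lift ord0 j)).
  exact: measurable_coord.
by apply/funext => x /=; rewrite mxE.
Qed.

Local Open Scope ereal_scope.

(** By induction, the image of the product of one-dimensional Lebesgue measure with the measure in
    dimension [n]; change of variables and Tonelli identify its integral with the recursion of
    [intRn]. Sigma-finiteness is carried along because Tonelli asks for it at every step. Dimension
    0 is a Dirac mass. *)
Lemma lebRn_exists n : {mu : {sigma_finite_measure set 'rV[R]_n -> \bar R} |
  forall f, measurable_fun setT f -> (forall x, 0 <= f x) ->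
    \int[mu]_x f x = intRn f}.
Proof.
elim: n => [|n [mu muE]].
  exists (\d_(0%R : 'rV[R]_0) : {sigma_finite_measure set _ -> \bar R}).
  by move=> f mf _; rewrite integral_dirac//= diracT mul1e.
pose leb : {sigma_finite_measure set (measurableTypeR R) -> \bar R} :=
  @lebesgue_measure R.
have /cid[nu nuE] := sigma_finite_transfer (sigma_finite_prod leb mu)
  (@measurable_rcons_rV n) (@measurable_runcons_rV n) (@rcons_rVK n).
exists nu => f mf f0.
have mr := @measurable_rcons_rV n.
have mfr : measurable_fun (setT : set (measurableTypeR R * 'rV[R]_n)%type)
    (f \o @rcons_rV n) by exact: measurableT_comp.
transitivity (\int[leb \x mu]_x (f \o @rcons_rV n) x).
  by rewrite nuE; exact: (ge0_integral_pushforward mr).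
apply: etrans (@fubini_tonelli1 _ _ _ _ _ leb mu _ mfr (fun x => f0 _)) _.
rewrite [RHS]/=; apply: eq_integral => t _; rewrite /fubini_F muE//.
  by apply: measurableT_comp => //; exact: measurable_pair1.
by move=> v; exact: f0.
Qed.

Definition lebRn n := sval (lebRn_exists n).

Lemma lebRnE n f : measurable_fun setT f -> (forall x, 0 <= f x) ->
  \int[lebRn n]_x f x = intRn f.
Proof. exact: svalP (lebRn_exists n) f. Qed.

End lebesgue_rV.

(** * Translations, reflections and products under Lebesgue measure on row vectors *)

Section lebesgue_rV_theory.
Context {R : realType}.
Local Open Scope ereal_scope.

Notation leb := (@lebesgue_measure R).

Definition preserves_lebesgue (phi : R -> R) :=
  measurable_fun setT phi /\
  forall F : R -> \bar R, measurable_fun setT F -> (forall t, 0 <= F t) ->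
    \int[leb]_t F (phi t) = \int[leb]_t F t.

Lemma preserves_lebesgueP (phi : measurableTypeR R -> measurableTypeR R) :
  measurable_fun setT phi ->
  (forall A, measurable A -> pushforward leb phi A = leb A) ->
  preserves_lebesgue phi.
Proof.
move=> mphi phiE; split => // F mF F0.
rewrite -[LHS](ge0_integral_pushforward mphi leb measurableT)//.
by apply: eq_measure_integral => A mA _; exact: phiE.
Qed.

Lemma preserves_lebesgueN : preserves_lebesgue -%R.
Proof.
by apply: preserves_lebesgueP => [|A mA]; [exact: oppr_measurable|exact: lebesgue_measureN].
Qed.

(** The translated measure agrees with Lebesgue measure on half-open intervals, which determine
    it. *)
Lemma preserves_lebesgueD c : preserves_lebesgue (+%R^~ c).
Proof.
have mc : measurable_fun setT (+%R^~ c : measurableTypeR R -> measurableTypeR R).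
  by apply: measurable_funD.
apply: preserves_lebesgueP => // A mA; apply/esym.
pose nu : {measure set (measurableTypeR R) -> \bar R} :=
  measure_function_pushforward__canonical__measure_function_Measure leb mc.
apply: (@lebesgue_measure_unique _ nu) => // _ [[a b] _ <-].
rewrite /nu /= /pushforward.
rewrite (_ : _ @^-1` _ = `]a - c, b - c]%classic)%R; last first.
  by apply/seteqP; split => x /=; rewrite !in_itv /= ltrBlDr lerBrDr.
rewrite /= !lebesgue_measure_itv/= !lte_fin ltrD2r.
by case: ifP => // _; rewrite -!EFinB; congr EFin; lra.
Qed.

Lemma lebRn_S n (f : 'rV[R]_n.+1 -> \bar R) :
  measurable_fun setT f -> (forall x, 0 <= f x) ->
  \int[lebRn n.+1]_x f x =
  \int[leb]_t \int[lebRn n]_v f (rcons_rV (t, v)).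
Proof.
move=> mf f0; rewrite lebRnE//=; apply: eq_integral => t _.
rewrite lebRnE//.
have mr : measurable_fun setT (fun v : 'rV[R]_n => rcons_rV (t, v)).
  apply: measurableT_comp; first exact: measurable_rcons_rV.
  exact: measurable_pair1.
exact: measurableT_comp.
Qed.

Lemma rcons_rV0 n t (v : 'rV[R]_n) : rcons_rV (t, v) ord0 ord0 = t.
Proof. by have := rcons_rVK (t, v) => -[]. Qed.

Lemma rcons_rVS n t (v : 'rV[R]_n) i :
  rcons_rV (t, v) ord0 (lift ord0 i) = v ord0 i.
Proof.
have [_ e] := rcons_rVK (t, v).
by have := congr1 (fun w : 'rV_n => w ord0 i) e; rewrite mxE.
Qed.

(** Peels off one coordinate at a time, and serves both the translations and the reflection
    [x -> - x]. *)
Lemma integral_lebRn_coordinatewise n (phi : 'I_n -> R -> R)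
    (f : 'rV[R]_n -> \bar R) :
  (forall i, preserves_lebesgue (phi i)) ->
  measurable_fun setT f -> (forall x, 0 <= f x) ->
  \int[lebRn n]_x f (\row_i phi i (x ord0 i))%R = \int[lebRn n]_x f x.
Proof.
have mphi m (psi : 'I_m -> R -> R) : (forall i, preserves_lebesgue (psi i)) ->
    measurable_fun setT (fun x : 'rV[R]_m => \row_i psi i (x ord0 i))%R.
  move=> psiP; apply: measurable_mx => i j.
  rewrite (_ : (fun t => _) = psi j \o (fun x : 'rV[R]_m => x ord0 j)).
    by apply: measurableT_comp; [exact: (psiP j).1|exact: measurable_coord].
  by apply/funext => x; rewrite /= mxE.
elim: n phi f => [|n IH] phi f phiP mf f0.
  by apply: eq_integral => x _; congr f; apply/rowP => -[].
have mfr : measurable_fun (setT : set (measurableTypeR R * 'rV[R]_n)%type)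
    (f \o @rcons_rV _ n).
  by apply: measurableT_comp => //; exact: measurable_rcons_rV.
rewrite !lebRn_S//; last first.
  exact: (measurableT_comp mf (mphi _ _ phiP)).
transitivity (\int[leb]_t \int[lebRn n]_v f (rcons_rV (phi ord0 t, v))).
  apply: eq_integral => t _.
  rewrite -(IH (fun i => phi (lift ord0 i)) (fun v => f (rcons_rV (phi ord0 t, v)))) //.
  - apply: eq_integral => v _; congr f.
    apply/rowP => j; rewrite [LHS]mxE.
    case: (unliftP ord0 j) => [i|] ->; last by rewrite !rcons_rV0.
    by rewrite !rcons_rVS [RHS]mxE.
  - by apply: (measurableT_comp mfr); exact: measurable_pair1.
apply: ((phiP ord0).2 (fun t => \int[lebRn n]_v f (rcons_rV (t, v))))
  => [|t]; last by apply: integral_ge0.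
exact: (@measurable_fun_fubini_tonelli_F _ _ _ _ _ (lebRn n) _ mfr (fun x => f0 _)).
Qed.

Lemma integral_lebRnD n (c : 'rV[R]_n) (f : 'rV[R]_n -> \bar R) :
  measurable_fun setT f -> (forall x, 0 <= f x) ->
  \int[lebRn n]_x f (x + c)%R = \int[lebRn n]_x f x.
Proof.
move=> mf f0; rewrite -(@integral_lebRn_coordinatewise _
  (fun i => +%R^~ (c ord0 i)) f)//; last by move=> i; exact: preserves_lebesgueD.
by apply: eq_integral => x _; congr f; apply/rowP => i; rewrite !mxE.
Qed.

Lemma integral_lebRnN n (f : 'rV[R]_n -> \bar R) :
  measurable_fun setT f -> (forall x, 0 <= f x) ->
  \int[lebRn n]_x f (- x)%R = \int[lebRn n]_x f x.
Proof.
move=> mf f0; rewrite -(@integral_lebRn_coordinatewise _ (fun _ => -%R) f)//; last first.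
  by move=> i; exact: preserves_lebesgueN.
by apply: eq_integral => x _; congr f; apply/rowP => i; rewrite !mxE.
Qed.

Lemma integral_lebRn_prod n (g : R -> R) c :
  measurable_fun setT g -> (forall t, 0 <= g t)%R ->
  \int[leb]_t (g t)%:E = c%:E ->
  \int[lebRn n]_x (\prod_(i < n) g (x ord0 i))%:E = (c ^+ n)%:E.
Proof.
move=> mg g0 gc; elim: n => [|n IH].
  rewrite lebRnE /= ?big_ord0 ?expr0//.
  - under eq_fun do rewrite big_ord0; exact: measurable_cst.
  - by move=> x; rewrite big_ord0 lee_fin.
have mp m : measurable_fun setT
    (fun x : 'rV[R]_m => (\prod_(i < m) g (x ord0 i))%:E).
  apply/measurable_EFinP; apply: measurable_prod => i _.
  by apply: (measurableT_comp mg); exact: measurable_coord.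
have p0 m (x : 'rV[R]_m) : 0 <= (\prod_(i < m) g (x ord0 i))%:E.
  by rewrite lee_fin prodr_ge0.
rewrite lebRn_S//.
have step t : \int[lebRn n]_v
    (\prod_(i < n.+1) g (rcons_rV (t, v) ord0 i))%:E = (g t)%:E * (c ^+ n)%:E.
  rewrite -IH -ge0_integralZl_EFin//; last exact: mp.
  apply: eq_integral => v _; rewrite big_ord_recl rcons_rV0 EFinM.
  by congr (_ * (_)%:E); apply: eq_bigr => i _; rewrite rcons_rVS.
under eq_integral => t _ do rewrite step.
rewrite /= ge0_integralZr//; last 3 first.
- exact/measurable_EFinP.
- by move=> t _; rewrite lee_fin.
- by rewrite lee_fin exprn_ge0// -lee_fin -gc integral_ge0// => t _; rewrite lee_fin.
by rewrite gc -EFinM exprS.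
Qed.

End lebesgue_rV_theory.

(** * Gaussian integrals *)

Section gaussian_integrals.
Context {R : realType}.
Notation leb := (@lebesgue_measure R).

Lemma integral_normal_fun0 (s : R) : s != 0 ->
  (\int[leb]_t (normal_fun 0 s t)%:E = (normal_peak s)^-1%:E)%E.
Proof.
move=> s0; have p0 := normal_peak_gt0 s0.
have : (\int[leb]_t (normal_pdf 0 s t)%:E = 1)%E by exact: integral_normal_pdf.
rewrite normal_pdfE//; under eq_integral do rewrite EFinM.
rewrite ge0_integralZl_EFin//; last 3 first.
- by move=> t _; rewrite lee_fin normal_fun_ge0.
- by apply/measurable_EFinP; exact: measurable_normal_fun.
- exact: ltW.
case: (\int[_]_t _)%E => [r|/eqP|/eqP].
- by rewrite -EFinM => -[e]; congr EFin; rewrite -[LHS]mul1r -(mulVf (lt0r_neq0 p0)) -mulrA e mulr1.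
- by rewrite gt0_muley ?lte_fin.
- by rewrite gt0_muleNy ?lte_fin.
Qed.

Lemma expR_sqnorm n (c : R) (x : 'rV[R]_n) :
  expR (- (c * sqnorm x)) = \prod_(i < n) expR (- (c * x ord0 i ^+ 2)).
Proof. by rewrite -expR_sum /sqnorm mulr_sumr sumrN. Qed.

Lemma integral_expR_sqr (c : R) : 0 < c -> exists2 K : R, 0 < K &
  (\int[leb]_t (expR (- (c * t ^+ 2)))%:E = K%:E)%E.
Proof.
(* The standard deviation for which [t^2 / (2 s^2) = c t^2]. *)
move=> c0; pose s := Num.sqrt (2 * c)^-1.
have s0 : s != 0 by rewrite gt_eqF// sqrtr_gt0 invr_gt0 mulr_gt0.
exists (normal_peak s)^-1; first by rewrite invr_gt0 normal_peak_gt0.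
rewrite -integral_normal_fun0//; apply: eq_integral => t _.
congr (expR _)%:E; rewrite subr0 sqr_sqrtr ?invr_ge0 ?mulr_ge0 ?(ltW c0)//.
by field; rewrite gt_eqF.
Qed.

Lemma measurable_sqnorm n : measurable_fun setT (@sqnorm R n).
Proof. by apply: continuous_measurable_mx; exact: sqnorm_continuous. Qed.

Lemma measurable_expR_sqnorm n (c : R) :
  measurable_fun setT (fun x : 'rV[R]_n => expR (- (c * sqnorm x))).
Proof.
apply: measurableT_comp => //; apply: measurableT_comp => //.
by apply: measurable_funM => //; exact: measurable_sqnorm.
Qed.

Lemma integral_expR_sqnorm n (c : R) : 0 < c -> exists2 K : R, 0 < K &
  (\int[lebRn n]_x (expR (- (c * sqnorm x)))%:E = K%:E)%E.
Proof.
move=> c0; have [K K0 KE] := integral_expR_sqr c0.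
exists (K ^+ n); first by rewrite exprn_gt0.
rewrite -(@integral_lebRn_prod _ n (fun t => expR (- (c * t ^+ 2))))//.
- by apply: eq_integral => x _; rewrite expR_sqnorm.
- apply: measurableT_comp => //; apply: measurableT_comp => //.
  by apply: measurable_funM => //; exact: measurable_funX.
Qed.

Lemma gauss_gt0 n (z : 'rV[R]_n) : 0 < gauss z.
Proof. by rewrite /gauss mulr_gt0 ?expR_gt0// powR_gt0// mulr_gt0// pi_gt0. Qed.

Lemma gaussE n (z : 'rV[R]_n) :
  gauss z = (2 * pi) `^ (- (n%:R / 2)) * expR (- (2^-1 * sqnorm z)).
Proof. by rewrite /gauss mulrC [in RHS]mulrC (mulrC 2^-1). Qed.

Lemma measurable_gauss n : measurable_fun setT (@gauss R n).
Proof.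
rewrite (_ : @gauss R n = fun z => (2 * pi) `^ (- (n%:R / 2)) * expR (- (2^-1 * sqnorm z))).
  by apply: measurable_funM => //; exact: measurable_expR_sqnorm.
by apply/funext => z; rewrite gaussE.
Qed.

Lemma integral_gauss n : (\int[lebRn n]_z (gauss z : R)%:E = 1)%E.
Proof.
have p0 : 0 < 2 * pi :> R by rewrite mulr_gt0// pi_gt0.
under eq_integral do rewrite gaussE EFinM.
have mE : measurable_fun setT (fun x : 'rV[R]_n => (expR (- (2^-1 * sqnorm x)))%:E).
  by apply/measurable_EFinP; exact: measurable_expR_sqnorm.
rewrite ge0_integralZl_EFin ?powR_ge0//.
under eq_integral do rewrite expR_sqnorm.
rewrite (@integral_lebRn_prod _ n (fun t => expR (- (2^-1 * t ^+ 2))) (Num.sqrt (2 * pi))).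
- have -> : Num.sqrt (2 * pi) ^+ n = (2 * pi) `^ (n%:R / 2) :> R.
    by rewrite -powR12_sqrt ?ltW// -powR_mulrn ?powR_ge0// -powRrM (mulrC 2^-1).
  by rewrite -EFinM powRN mulVf// gt_eqF// powR_gt0.
- apply: measurableT_comp => //; apply: measurableT_comp => //.
  by apply: measurable_funM => //; exact: measurable_funX.
- by move=> t; exact: expR_ge0.
have := integral_normal_fun0 (oner_neq0 R).
rewrite /normal_peak invrK expr1n mul1r -mulr_natl => <-.
apply: eq_integral => t _; congr (expR _)%:E.
by rewrite subr0 expr1n; field.
Qed.

Lemma integral_gauss_sqnorm n : exists2 S : R, 0 <= S &
  (\int[lebRn n]_z (gauss z * sqnorm z)%:E = S%:E)%E.
Proof.
have c0 : 0 < 4^-1 :> R by rewrite invr_gt0.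
have [K K0 KE] := integral_expR_sqnorm n c0.
set I := (\int[_]_z _)%E.
have gs0 (z : 'rV[R]_n) : 0 <= gauss z * sqnorm z.
  by rewrite mulr_ge0 ?sqnorm_ge0// ltW// gauss_gt0.
have I0 : (0 <= I)%E by apply: integral_ge0 => z _; rewrite lee_fin.
suff Ioo : (I < +oo)%E.
  exists (fine I); first exact: fine_ge0.
  by rewrite fineK// ge0_fin_numE.
(* From [u <= expR u] at [u = |z|^2 / 4]: the second moment spends half of the Gaussian exponent and
   is dominated by [C expR (- |z|^2 / 4)]. *)
pose C : R := (2 * pi) `^ (- (n%:R / 2)) * 4.
have C0 : 0 <= C by rewrite mulr_ge0// powR_ge0.
apply: (@le_lt_trans _ _ (\int[lebRn n]_z (C * expR (- (4^-1 * sqnorm z)))%:E)%E); last first.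
  under eq_integral do rewrite EFinM.
  rewrite ge0_integralZl_EFin//; first by rewrite KE -EFinM ltry.
  by apply/measurable_EFinP; exact: measurable_expR_sqnorm.
apply: ge0_le_integral => //.
- by move=> z _; rewrite lee_fin.
- apply/measurable_EFinP; apply: measurable_funM; first exact: measurable_gauss.
  exact: measurable_sqnorm.
- apply/measurable_EFinP; apply: measurable_funM => //.
  exact: measurable_expR_sqnorm.
move=> z _; rewrite lee_fin gaussE /C -!mulrA ler_wpM2l ?powR_ge0//.
have h : sqnorm z / 4 <= expR (sqnorm z / 4).
  by apply: le_trans (expR_ge1Dx _); rewrite lerDr.
have -> : - (2^-1 * sqnorm z) = - (4^-1 * sqnorm z) + - (sqnorm z / 4) by field.
rewrite expRD -mulrA (mulrC 4) ler_wpM2l ?expR_ge0//.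
rewrite expRN mulrC ler_pdivrMr ?expR_gt0//; lra.
Qed.

End gaussian_integrals.

(** * HMC transition operator *)

Section measurable_vectors.
Context {R : realType} {dT} {T : measurableType dT}.

Lemma measurable_coordP m n (f : T -> 'M[R]_(m, n)) i j :
  measurable_fun setT f -> measurable_fun setT (fun t => f t i j).
Proof. by move=> mf; exact: (measurableT_comp (measurable_coord i j) mf). Qed.

Lemma measurable_addmx m n (f g : T -> 'M[R]_(m, n)) :
  measurable_fun setT f -> measurable_fun setT g ->
  measurable_fun setT (fun t => f t + g t).
Proof.
move=> mf mg; apply: measurable_mx => i j.
rewrite (_ : (fun t => _) = fun t => f t i j + g t i j); last first.
  by apply/funext => t; rewrite mxE.
by apply: measurable_funD; exact: measurable_coordP.
Qed.

Lemma measurable_scalemx m n (c : R) (f : T -> 'M[R]_(m, n)) :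
  measurable_fun setT f -> measurable_fun setT (fun t => c *: f t).
Proof.
move=> mf; apply: measurable_mx => i j.
rewrite (_ : (fun t => _) = fun t => c * f t i j); last first.
  by apply/funext => t; rewrite mxE.
by apply: measurable_funM => //; exact: measurable_coordP.
Qed.

Lemma measurable_oppmx m n (f : T -> 'M[R]_(m, n)) :
  measurable_fun setT f -> measurable_fun setT (fun t => - f t).
Proof.
move=> mf; rewrite (_ : (fun t => _) = fun t => -1 *: f t).
  exact: measurable_scalemx.
by apply/funext => t; rewrite scaleN1r.
Qed.

End measurable_vectors.

Section hmc_measurable.
Context {R : realType} {d : nat}.
Notation V := 'rV[R]_d.
Notation mu := (@lebRn R d).
Variables (W : V -> R) (G : V -> V) (eps : R).
Hypothesis mW : measurable_fun setT W.
Hypothesis mG : measurable_fun setT G.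

Lemma measurable_lf1 : measurable_fun (setT : set (V * V)) (lf1 G eps).
Proof.
have mGc (h : V * V -> V) : measurable_fun setT h ->
    measurable_fun setT (fun w => - ((eps / 2) *: G (h w))).
  move=> mh; apply: measurable_oppmx; apply: measurable_scalemx.
  exact: measurableT_comp.
have m1 : measurable_fun (setT : set (V * V)) (fun w => w.2 - (eps / 2) *: G w.1).
  by apply: measurable_addmx => //; exact: mGc.
have m2 : measurable_fun (setT : set (V * V))
    (fun w => w.1 + eps *: (w.2 - (eps / 2) *: G w.1)).
  by apply: measurable_addmx => //; exact: measurable_scalemx.
apply/measurable_fun_pairP; split; first exact: m2.
by apply: measurable_addmx => //; exact: mGc.
Qed.

Lemma measurable_lf L : measurable_fun (setT : set (V * V)) (lf G eps L).
Proof.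
elim: L => [|L IH]; first exact: measurable_id.
exact: (measurableT_comp measurable_lf1 IH).
Qed.

Lemma measurable_ham : measurable_fun (setT : set (V * V)) (ham W).
Proof.
apply: measurable_funD; first exact: measurableT_comp.
apply: measurable_funM => //; apply: measurableT_comp => //.
exact: measurable_sqnorm.
Qed.

Lemma measurable_acc L : measurable_fun (setT : set (V * V)) (acc W G eps L).
Proof.
apply: measurable_minr => //; apply: measurableT_comp => //.
apply: measurable_funD; last exact: measurable_ham.
apply: measurableT_comp => //.
exact: (measurableT_comp measurable_ham (measurable_lf L)).
Qed.

End hmc_measurable.

Section hmc_operator.
Context {R : realType} {d : nat}.
Notation V := 'rV[R]_d.
Notation mu := (@lebRn R d).
Variables (W : V -> R) (G : V -> V) (eps : R).
Hypothesis mW : measurable_fun setT W.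
Hypothesis mG : measurable_fun setT G.
Variable pL : nat -> R.
Hypothesis pL_ge0 : forall L, 0 <= pL L.
Hypothesis pL_sum : (\sum_(0 <= L <oo) (pL L)%:E)%E = 1%E.
Local Open Scope ereal_scope.
Implicit Types (f g : V -> \bar R) (w : V * V).
Notation acc := (acc W G eps).
Notation lf := (lf G eps).

Definition hmc_step L f w : \bar R :=
  (acc L w)%:E * f (lf L w).1 + (1 - acc L w)%R%:E * f w.1.

(** [hmc_op] with potential and gradient abstracted, kept in terms of [intRn] so that the two stay
    convertible; [hopE] passes to the measure integrals [hmc_move]. *)
Definition hop f x : \bar R :=
  \sum_(0 <= L <oo) (pL L)%:E *
    intRn (fun z => (gauss z)%:E * hmc_step L f (x, z)).

Definition hmc_move L f x : \bar R := \int[mu]_z ((gauss z)%:E * hmc_step L f (x, z)).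

Let acc0 L w : 0 <= (acc L w)%:E. Proof. by rewrite lee_fin acc_ge0. Qed.
Let rej0 L w : 0 <= (1 - acc L w)%R%:E.
Proof. by rewrite lee_fin subr_ge0 acc_le1. Qed.
Let g0 (z : V) : 0 <= (gauss z : R)%:E.
Proof. by rewrite lee_fin ltW// gauss_gt0. Qed.

Lemma hmc_step_ge0 L f w : (forall x, 0 <= f x) -> 0 <= hmc_step L f w.
Proof. by move=> f0; rewrite adde_ge0// mule_ge0. Qed.

Let gstep_ge0 L f x z : (forall x, 0 <= f x) ->
  0 <= (gauss z)%:E * hmc_step L f (x, z).
Proof. by move=> f0; rewrite mule_ge0// hmc_step_ge0. Qed.

Lemma measurable_hmc_step L f : measurable_fun setT f -> measurable_fun setT (hmc_step L f).
Proof.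
move=> mf; have ma := measurable_acc eps mW mG L.
apply: emeasurable_funD; apply: emeasurable_funM.
- exact/measurable_EFinP.
- apply: measurableT_comp => //; apply: measurableT_comp => //.
  exact: measurable_lf.
- by apply/measurable_EFinP; exact: measurable_funB.
- exact: measurableT_comp.
Qed.

Lemma measurable_gstep L f : measurable_fun setT f ->
  measurable_fun setT (fun w : V * V => (gauss w.2)%:E * hmc_step L f w).
Proof.
move=> mf; apply: emeasurable_funM; last exact: measurable_hmc_step.
by apply/measurable_EFinP; apply: measurableT_comp => //; exact: measurable_gauss.
Qed.

Lemma measurable_gstepz L f x : measurable_fun setT f ->
  measurable_fun setT (fun z => (gauss z)%:E * hmc_step L f (x, z)).
Proof.
move=> /(measurable_gstep L) mg.
exact: (measurable_fun_pair2 x mg).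
Qed.

Lemma hopE f x : measurable_fun setT f -> (forall x, 0 <= f x) ->
  hop f x = \sum_(0 <= L <oo) (pL L)%:E * hmc_move L f x.
Proof.
move=> mf f0; apply: eq_eseriesr => L _; rewrite /hmc_move lebRnE//.
- exact: measurable_gstepz.
- by move=> z; exact: gstep_ge0.
Qed.

Lemma hmc_move_ge0 L f x : (forall x, 0 <= f x) -> 0 <= hmc_move L f x.
Proof. by move=> f0; apply: integral_ge0 => z _; exact: gstep_ge0. Qed.

Let pmove_ge0 L f x : (forall x, 0 <= f x) -> 0 <= (pL L)%:E * hmc_move L f x.
Proof. by move=> f0; rewrite mule_ge0 ?hmc_move_ge0// lee_fin. Qed.

Lemma measurable_hmc_move L f : measurable_fun setT f -> (forall x, 0 <= f x) ->
  measurable_fun setT (hmc_move L f).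
Proof.
move=> mf f0.
apply: (@measurable_fun_fubini_tonelli_F _ _ _ _ _ mu _ (measurable_gstep L mf)).
by move=> -[x z]; exact: gstep_ge0.
Qed.

Lemma measurable_hop f : measurable_fun setT f -> (forall x, 0 <= f x) ->
  measurable_fun setT (hop f).
Proof.
move=> mf f0.
rewrite (_ : hop f = fun x => \sum_(0 <= L <oo) (pL L)%:E * hmc_move L f x); last first.
  by apply/funext => x; rewrite hopE.
apply: ge0_emeasurable_sum => [L x _ _|L _]; first exact: pmove_ge0.
by apply: emeasurable_funM => //; exact: measurable_hmc_move.
Qed.

Lemma intRn_ge0 n (h : 'rV[R]_n -> \bar R) : (forall v, 0 <= h v) -> 0 <= intRn h.
Proof.
elim: n h => [|n IH] h h0 /=; first exact: h0.
by apply: integral_ge0 => t _; apply: IH => v; exact: h0.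
Qed.

Lemma hop_ge0 f : (forall x, 0 <= f x) -> forall x, 0 <= hop f x.
Proof.
move=> f0 x; apply: nneseries_ge0 => L _ _; rewrite mule_ge0// ?lee_fin//.
by apply: intRn_ge0 => z; exact: gstep_ge0.
Qed.

Lemma hmc_moveD L f g x : measurable_fun setT f -> measurable_fun setT g ->
  (forall x, 0 <= f x) -> (forall x, 0 <= g x) ->
  hmc_move L (fun y => f y + g y) x = hmc_move L f x + hmc_move L g x.
Proof.
move=> mf mg f0 h0.
rewrite /hmc_move -ge0_integralD//; [|by move=> z _; exact: gstep_ge0
  |exact: measurable_gstepz|by move=> z _; exact: gstep_ge0|exact: measurable_gstepz].
apply: eq_integral => z _.
rewrite /hmc_step !ge0_muleDr ?adde_ge0 ?mule_ge0//.
by rewrite addeACA.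
Qed.

Lemma hopD f g : measurable_fun setT f -> measurable_fun setT g ->
  (forall x, 0 <= f x) -> (forall x, 0 <= g x) ->
  forall x, hop (fun y => f y + g y) x = hop f x + hop g x.
Proof.
move=> mf mg f0 h0 x.
rewrite !hopE//; [|exact: emeasurable_funD|by move=> y; rewrite adde_ge0].
rewrite -nneseriesD; [|by move=> *; exact: pmove_ge0|by move=> *; exact: pmove_ge0].
apply: eq_eseriesr => L _; rewrite hmc_moveD// ge0_muleDr//; exact: hmc_move_ge0.
Qed.

Lemma hopZ (c : R) f : (0 <= c)%R -> measurable_fun setT f ->
  (forall x, 0 <= f x) -> forall x, hop (fun y => c%:E * f y) x = c%:E * hop f x.
Proof.
move=> c0 mf f0 x.
have c0' : 0 <= c%:E by rewrite lee_fin.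
rewrite !hopE//; [|exact: emeasurable_funM|by move=> y; rewrite mule_ge0].
rewrite -nneseriesZl; last by move=> *; exact: pmove_ge0.
apply: eq_eseriesr => L _; rewrite muleCA; congr (_ * _).
rewrite /hmc_move -ge0_integralZl_EFin//; [|by move=> z _; exact: gstep_ge0
  |exact: measurable_gstepz].
apply: eq_integral => z _; rewrite muleCA; congr (_ * _).
by rewrite /hmc_step ge0_muleDr ?mule_ge0//; congr (_ + _); rewrite muleCA.
Qed.

Lemma hmc_move_cst L (c : R) x : (0 <= c)%R -> hmc_move L (cst c%:E) x = c%:E.
Proof.
move=> c0; rewrite -[RHS]mule1 -(integral_gauss d) -ge0_integralZl_EFin//; last first.
  by apply/measurable_EFinP; exact: measurable_gauss.
apply: eq_integral => z _; rewrite /hmc_step /cst -!EFinM.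
by congr EFin; ring.
Qed.

Lemma hop_cst (c : R) : (0 <= c)%R -> forall x, hop (cst c%:E) x = c%:E.
Proof.
move=> c0 x; rewrite hopE//.
under eq_eseriesr do rewrite hmc_move_cst// muleC.
by rewrite nneseriesZl ?pL_sum ?mule1// => *; rewrite lee_fin.
Qed.

Lemma hmc_move_le L f g x : measurable_fun setT f -> measurable_fun setT g ->
  (forall x, 0 <= f x) -> (forall x, f x <= g x) -> hmc_move L f x <= hmc_move L g x.
Proof.
move=> mf mg f0 fg; apply: ge0_le_integral => //.
- by move=> z _; exact: gstep_ge0.
- exact: measurable_gstepz.
- exact: measurable_gstepz.
- by move=> z _; rewrite lee_pmul2l ?lte_fin ?gauss_gt0// leeD// lee_wpmul2l.
Qed.

Lemma hop_le f g : measurable_fun setT f -> measurable_fun setT g ->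
  (forall x, 0 <= f x) -> (forall x, f x <= g x) -> forall x, hop f x <= hop g x.
Proof.
move=> mf mg f0 fg x.
have h0 y : 0 <= g y by exact: le_trans (fg y).
rewrite !hopE//; apply: lee_nneseries => [L _ _|L _]; first exact: pmove_ge0.
by rewrite lee_wpmul2l ?lee_fin// hmc_move_le.
Qed.

Lemma hop_ge_hmc_move L f x : measurable_fun setT f -> (forall x, 0 <= f x) ->
  (pL L)%:E * hmc_move L f x <= hop f x.
Proof.
move=> mf f0; rewrite hopE//.
apply: le_trans (nneseries_lim_ge L.+1 _) => /=; last by move=> *; exact: pmove_ge0.
rewrite big_nat_recr//= leeDr// sume_ge0// => *; exact: pmove_ge0.
Qed.

End hmc_operator.

(** * Drift and minorization *)

Section drift_minorization.
Context {R : realType} {d : nat}.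
Notation V := 'rV[R]_d.
Notation mu := (@lebRn R d).
Variables (W : V -> R) (G : V -> V) (lam eps : R).
Hypothesis mW : measurable_fun setT W.
Hypothesis mG : measurable_fun setT G.
Hypothesis lam0 : 0 < lam.
Hypothesis coco : cocoercive lam W G.
Hypothesis eps0 : 0 < eps.
Hypothesis eps_lam : eps ^+ 2 <= 2 * lam.
Variable pL : nat -> R.
Hypothesis pL_ge0 : forall L, 0 <= pL L.
Hypothesis pL_sum : (\sum_(0 <= L <oo) (pL L)%:E)%E = 1%E.
Hypothesis pL1 : 0 < pL 1%N.
Variable m : R.
Hypothesis W_ge : forall x, m <= W x.
Notation hop := (hop W G eps pL).
Notation hmc_move := (hmc_move W G eps).
Notation acc := (acc W G eps).
Notation lf := (lf G eps).
Let excess x := W x - m.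

Let excess_ge0 x : 0 <= excess x. Proof. by rewrite subr_ge0. Qed.

Let measurable_excess : measurable_fun setT excess.
Proof. exact: measurable_funB. Qed.

Let mE (f : V -> R) : measurable_fun setT f -> measurable_fun setT (EFin \o f).
Proof. by move=> mf; exact/measurable_EFinP. Qed.

Lemma integral_gauss_affine (S A B : R) : 0 <= A -> 0 <= B ->
  (\int[mu]_z (gauss z * sqnorm z)%:E = S%:E)%E ->
  (\int[mu]_z (gauss z * (A + B * sqnorm z))%:E = (A + B * S)%:E)%E.
Proof.
move=> A0 B0 SE.
have g0 (z : V) : 0 <= gauss z by rewrite ltW// gauss_gt0.
have mg := @measurable_gauss R d; have ms := @measurable_sqnorm R d.
transitivity (\int[mu]_z (A%:E * (gauss z)%:E + B%:E * (gauss z * sqnorm z)%:E))%E.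
  by apply: eq_integral => z _; rewrite -!EFinM -EFinD; congr EFin; ring.
have mgs : measurable_fun setT (EFin \o (fun z : V => gauss z * sqnorm z)).
  by apply: mE; exact: measurable_funM.
have mge := mE mg.
have gs0 (z : V) : (0 <= (gauss z * sqnorm z)%:E)%E.
  by rewrite lee_fin mulr_ge0// sqnorm_ge0.
have ge0' (z : V) : (0 <= (gauss z : R)%:E)%E by rewrite lee_fin.
have A0' : (0 <= A%:E)%E by rewrite lee_fin.
have B0' : (0 <= B%:E)%E by rewrite lee_fin.
rewrite ge0_integralD//; [|by move=> z _; rewrite mule_ge0|
  by apply: emeasurable_funM|by move=> z _; rewrite mule_ge0|
  by apply: emeasurable_funM].
rewrite !ge0_integralZl_EFin//.
by rewrite integral_gauss SE mule1 -EFinM -EFinD.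
Qed.

Let step_excess L w : hmc_step W G eps L (EFin \o excess) w =
  (excess w.1 + acc L w * (W (lf L w).1 - W w.1))%:E.
Proof.
rewrite /hmc_step /= -!EFinM -EFinD /excess; congr EFin; ring.
Qed.

Let gstep_ge0 L x z :
  (0 <= (gauss z)%:E * hmc_step W G eps L (EFin \o excess) (x, z))%E.
Proof.
apply: mule_ge0; first by rewrite lee_fin ltW// gauss_gt0.
by apply: hmc_step_ge0 => y; rewrite lee_fin.
Qed.

Let move_excess_le L (S : R) x :
  (\int[mu]_z (gauss z * sqnorm z)%:E = S%:E)%E ->
  (hmc_move L (EFin \o excess) x <= (excess x + 1 + 2^-1 * S)%:E)%E.
Proof.
move=> SE; rewrite -(integral_gauss_affine _ _ SE)//; last by rewrite addr_ge0.
apply: ge0_le_integral => //.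
- by apply: measurable_gstepz => //; exact: mE.
- apply: mE; apply: measurable_funM; first exact: measurable_gauss.
  apply: measurable_funD => //; apply: measurable_funM => //.
  exact: measurable_sqnorm.
move=> z _; rewrite step_excess -EFinM lee_fin ler_pM2l ?gauss_gt0//=.
rewrite -[leRHS]addrA lerD2l; apply: le_trans (acc_increase _ _ _ _ _) _ => /=.
by rewrite addrC mulrC.
Qed.

Variables c1 c2 : R.
Hypothesis c1_gt0 : 0 < c1.
Hypothesis c2_ge0 : 0 <= c2.
Hypothesis G_ge : forall x, c1 * (W x - m) - c2 <= sqnorm (G x).

(** [eta] is the Gaussian mean of the lower bound on the one-step acceptance probability. The gain
    stands on the left, so both sides are integrals of nonnegative functions and can be compared
    pointwise in [z]. *)
Let move1_excess_le (S eta : R) x :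
  (\int[mu]_z (gauss z * sqnorm z)%:E = S%:E)%E ->
  (\int[mu]_z (gauss z * expR (- (sqnorm z / 2)))%:E = eta%:E)%E ->
  (hmc_move 1 (EFin \o excess) x + (eps ^+ 2 / 4 * c1 * excess x * eta)%:E
    <= (excess x + eps ^+ 2 / 4 * c2 + 1 * S)%:E)%E.
Proof.
move=> SE etaE.
pose k := eps ^+ 2 / 4; have k0 : 0 <= k by rewrite divr_ge0// sqr_ge0.
rewrite -(integral_gauss_affine _ _ SE)//; last by rewrite addr_ge0// mulr_ge0.
have kx0 : 0 <= k * c1 * excess x by rewrite !mulr_ge0// ltW.
have mge : measurable_fun setT (fun z : V => gauss z * expR (- (sqnorm z / 2))).
  apply: measurable_funM; first exact: measurable_gauss.
  apply: measurableT_comp => //; apply: measurableT_comp => //.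
  by apply: measurable_funM => //; exact: measurable_sqnorm.
have ge0' (z : V) : 0 <= gauss z * expR (- (sqnorm z / 2)).
  by rewrite mulr_ge0 ?expR_ge0// ltW// gauss_gt0.
rewrite (EFinM _ eta) -etaE -ge0_integralZl_EFin//; last 2 first.
- by move=> z _; rewrite lee_fin.
- exact: mE.
have st0 (z : V) : (0 <= (gauss z)%:E * hmc_step W G eps 1 (EFin \o excess) (x, z))%E.
  exact: gstep_ge0.
have mst : measurable_fun setT
    (fun z : V => ((gauss z)%:E * hmc_step W G eps 1 (EFin \o excess) (x, z))%E).
  by apply: measurable_gstepz => //; exact: mE.
rewrite -ge0_integralD//; last 2 first.
- by move=> z _; rewrite -EFinM lee_fin mulr_ge0.
- by apply: emeasurable_funM => //; exact: mE.
apply: ge0_le_integral => //.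
- by move=> z _; rewrite adde_ge0// -EFinM lee_fin mulr_ge0.
- by apply: emeasurable_funD => //; apply: emeasurable_funM => //; exact: mE.
- apply: mE; apply: measurable_funM; first exact: measurable_gauss.
  apply: measurable_funD => //; apply: measurable_funM => //.
  exact: measurable_sqnorm.
move=> z _; rewrite step_excess -!EFinM -EFinD lee_fin mulrCA -mulrDr.
rewrite ler_pM2l ?gauss_gt0//= mul1r.
have h1 := lf1_descent lam0 coco eps_lam (x, z).
have h2 := acc1_ge coco eps_lam (x, z).
have h3 := acc_le1 W G eps 1 (x, z).
have h0 := acc_ge0 W G eps 1 (x, z).
have h4 := G_ge x.
have h5 : 0 <= sqnorm z by exact: sqnorm_ge0.
have h6 := sqnorm_ge0 (G x).
have e0 : 0 <= expR (- (sqnorm z / 2)) by exact: expR_ge0.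
move: h0 h1 h2 h3 h4 h5 h6 e0; rewrite /lf /= -/k -/(excess x).
set u := W (_ + _); set a := acc _ _; set e := expR _.
move: u a e (W x) (excess x) (sqnorm (G x)) (sqnorm z).
move=> u a e w E g s a0 h1 ea a1 hg s0 g0 e0.
(* The change of [W] has a positive part [s], weighted using [a <= 1], and a negative part [- k g],
   weighted using [a >= e]. *)
have i1 : a * (u - w) <= a * (s - k * g) by apply: ler_wpM2l => //; lra.
have i2 : a * s <= s by rewrite ler_piMl.
have kg0 : 0 <= k * g by rewrite mulr_ge0.
have i3 : e * (k * g) <= a * (k * g) by rewrite ler_wpM2r.
have ek0 : 0 <= e * k by rewrite mulr_ge0.
have i4 : e * k * (c1 * E - c2) <= e * k * g by rewrite ler_wpM2l.
have kc0 : 0 <= k * c2 by rewrite mulr_ge0.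
have i5 : e * (k * c2) <= k * c2 by rewrite ler_piMl// (le_trans ea).
lra.
Qed.

Lemma hop_drift : exists gam K : R, [/\ gam < 1, 0 <= K &
  forall x, (hop (EFin \o excess) x <= (gam * excess x + K)%:E)%E].
Proof.
have [S S0 SE] := @integral_gauss_sqnorm R d.
have [K1 K10 K1E] := @integral_expR_sqnorm R d 1 ltr01.
pose C : R := (2 * pi) `^ (- (d%:R / 2)).
have C0 : 0 < C by rewrite powR_gt0// mulr_gt0// pi_gt0.
have etaE : (\int[mu]_z (gauss z * expR (- (sqnorm z / 2)))%:E = (C * K1)%:E)%E.
  rewrite (EFinM C) -K1E -ge0_integralZl_EFin//; last 2 first.
  - by apply: mE; exact: measurable_expR_sqnorm.
  - exact: ltW.
  apply: eq_integral => z _; rewrite gaussE -EFinM -mulrA -expRD.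
  by congr (C * expR _)%:E; field.
pose k := eps ^+ 2 / 4; have k0 : 0 < k by rewrite divr_gt0// exprn_gt0.
pose del := k * c1 * (C * K1).
have del0 : 0 < del by rewrite !mulr_gt0.
(* Majorizes both additive constants: [1 + S / 2] for an arbitrary trajectory and [k c2 + S] for a
   single step. *)
pose K := k * c2 + 1 + S.
have K0 : 0 <= K by rewrite !addr_ge0// mulr_ge0// ltW.
exists (1 - pL 1%N * del), K; split => //.
  by rewrite ltrBlDr ltrDl mulr_gt0.
move=> x.
have e0 y : (0 <= (EFin \o excess) y)%E by rewrite lee_fin.
have me := mE measurable_excess.
have dx0 : 0 <= del * excess x by rewrite mulr_ge0// ltW.
have bound L : ((pL L)%:E * hmc_move L (EFin \o excess) x
    + (pL L)%:E * (if L == 1%N then del * excess x else 0)%:E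
    <= (pL L)%:E * (excess x + K)%:E)%E.
  rewrite -ge0_muleDr ?hmc_move_ge0// ?lee_fin; last by case: ifP.
  rewrite lee_wpmul2l ?lee_fin//.
  case: ifPn => [/eqP ->|_].
    have -> : del * excess x = eps ^+ 2 / 4 * c1 * excess x * (C * K1).
      by rewrite /del mulrAC.
    apply: (le_trans (move1_excess_le _ SE etaE)).
    by rewrite lee_fin /K -/k; lra.
  rewrite adde0; apply: (le_trans (move_excess_le _ _ SE)).
  rewrite lee_fin /K; have : 0 <= k * c2 by rewrite mulr_ge0// ltW.
  lra.
have : (\sum_(0 <= L <oo) ((pL L)%:E * hmc_move L (EFin \o excess) x
    + (pL L)%:E * (if L == 1%N then del * excess x else 0)%:E)
    <= \sum_(0 <= L <oo) (pL L)%:E * (excess x + K)%:E)%E.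
  apply: lee_nneseries => // L _ _.
  rewrite adde_ge0// mule_ge0 ?lee_fin ?hmc_move_ge0//.
  by case: ifP.
rewrite nneseriesD; last 2 first.
- by move=> L _ _; rewrite mule_ge0 ?lee_fin ?hmc_move_ge0.
- by move=> L _ _; rewrite mule_ge0 ?lee_fin//; case: ifP.
rewrite -hopE//.
under [in leRHS]eq_eseriesr do rewrite muleC.
rewrite nneseriesZl ?pL_sum ?mule1; last by move=> *; rewrite lee_fin.
have : ((pL 1%N * (del * excess x))%:E <=
    \sum_(0 <= L <oo) (pL L)%:E * (if L == 1%N then del * excess x else 0)%:E)%E.
  apply: le_trans (nneseries_lim_ge 2 _) => /=; last first.
    by move=> L _ _; rewrite mule_ge0 ?lee_fin//; case: ifP.
  by rewrite !big_nat_recr//= big_geq//= mule0 !add0e -EFinM.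
have : (0 <= hop (EFin \o excess) x)%E by exact: hop_ge0.
case: (hop _ _) => [r||]; case: (\sum_(0 <= L <oo) _)%E => [t||] //=.
rewrite -EFinD !lee_fin => _ h1 h2.
lra.
Qed.

End drift_minorization.

Lemma sqnormB_le (R : realType) d (x y : 'rV[R]_d) :
  sqnorm (x - y) <= 2 * sqnorm x + 2 * sqnorm y.
Proof.
have := young 1 x (- y); rewrite sqnormB dotNr sqnormN; lra.
Qed.

(** * Minorization on sublevel sets *)

Section minorization.
Context {R : realType} {d : nat}.
Notation V := 'rV[R]_d.
Notation mu := (@lebRn R d).
Variables (W : V -> R) (G : V -> V) (lam eps : R).
Hypothesis mW : measurable_fun setT W.
Hypothesis mG : measurable_fun setT G.
Hypothesis lam0 : 0 < lam.
Hypothesis coco : cocoercive lam W G.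
Hypothesis eps0 : 0 < eps.
Hypothesis eps_lam : eps ^+ 2 <= 2 * lam.
Variable pL : nat -> R.
Hypothesis pL_ge0 : forall L, 0 <= pL L.
Hypothesis pL1 : 0 < pL 1%N.
Variables m b1 b2 : R.
Hypothesis W_ge : forall x, m <= W x.
Hypothesis b1_gt0 : 0 < b1.
Hypothesis W_quad : forall x, b1 * sqnorm x - b2 <= W x.
Notation hop := (hop W G eps pL).
Notation hmc_move := (hmc_move W G eps).

(** The position after one step is [eps *: (z + mean x)]: a one-step proposal is Gaussian, centred
    at [eps *: mean x]. *)
Let mean x : V := eps^-1 *: x - (eps / 2) *: G x.

Let lf1_mean x z : (lf1 G eps (x, z)).1 = eps *: (z + mean x).
Proof.
rewrite /lf1 /mean /=; move: (G x) => a; apply/rowP => i; rewrite !mxE.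
by field; rewrite gt_eqF.
Qed.

Let mean_bounded r : exists B : R, forall x, W x - m <= r -> sqnorm (mean x) <= B.
Proof.
pose rho := (r + m + b2) / b1.
pose D := 2 * sqnorm (G 0) + 2 * (lam ^- 2 * rho).
exists (2 * (eps ^- 2 * rho) + 2 * ((eps / 2) ^+ 2 * D)) => x xr.
have xrho : sqnorm x <= rho.
  by rewrite ler_pdivlMr// mulrC; have := W_quad x; lra.
have GD : sqnorm (G x) <= D.
  have -> : G x = (G x - G 0) - (- G 0) by rewrite opprK subrK.
  apply: (le_trans (sqnormB_le _ _)); rewrite sqnormN /D addrC lerD2l ler_pM2l//.
  have h := coco_lipschitz lam0 coco 0 x; rewrite subr0 in h.
  rewrite mulrC ler_pdivlMr ?exprn_gt0// mulrC; exact: le_trans h xrho.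
apply: (le_trans (sqnormB_le _ _)); rewrite !sqnormZ exprVn.
apply: lerD; rewrite ler_pM2l//; apply: ler_wpM2l => //.
- by rewrite invr_ge0 sqr_ge0.
- exact: sqr_ge0.
Qed.

Let C : R := (2 * pi) `^ (- (d%:R / 2)).
Let C0 : 0 < C. Proof. by rewrite powR_gt0// mulr_gt0// pi_gt0. Qed.

Let mex (c : R) : measurable_fun setT (fun z : V => (expR (- (c * sqnorm z)))%:E).
Proof. by apply/measurable_EFinP; exact: measurable_expR_sqnorm. Qed.

(** Only accepted single steps are kept. Density times acceptance is at least [C expR (- |z|^2)];
    after translating by [w = mean x], the bound [|z - w|^2 <= 2 |z|^2 + 2 |w|^2] and boundedness of
    [mean] on the sublevel set remove the dependence on [x], at the cost of [expR (- (2 * B))]. *)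
Let hop_lower r : exists2 A : R, 0 < A & forall x (h : V -> \bar R),
  W x - m <= r -> measurable_fun setT h -> (forall y, 0 <= h y)%E ->
  (A%:E * \int[mu]_z ((expR (- (2 * sqnorm z)))%:E * h (eps *: z)) <= hop h x)%E.
Proof.
have [B hB] := mean_bounded r.
exists (pL 1%N * (C * expR (- (2 * B)))); first by rewrite !mulr_gt0 ?expR_gt0.
move=> x h xr mh h0; set w := mean x; have wB : sqnorm w <= B by exact: hB.
apply: le_trans (hop_ge_hmc_move eps mW mG pL_ge0 1 x mh h0).
rewrite EFinM -muleA; apply: lee_wpmul2l; first by rewrite lee_fin.
have mhe : measurable_fun setT (fun z : V => h (eps *: z)).
  by apply: measurableT_comp => //; exact: measurable_scalemx.
pose F (z : V) := (C%:E * ((expR (- (1 * sqnorm (z - w))))%:E * h (eps *: z)))%E.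
have mF : measurable_fun setT F.
  apply: emeasurable_funM => //; apply: emeasurable_funM => //.
  apply: (measurableT_comp (mex 1)); apply: measurable_addmx => //.
have F0 z : (0 <= F z)%E by rewrite !mule_ge0// ?lee_fin ?expR_ge0// ltW.
apply: (@le_trans _ _ (\int[mu]_z F (z + w)%R)%E); last first.
  apply: ge0_le_integral => //.
  - by apply: (measurableT_comp mF); exact: measurable_addmx.
  - exact: measurable_gstepz.
  move=> z _.
  have e1 : (lf G eps 1 (x, z)).1 = eps *: (z + w) by exact: lf1_mean.
  rewrite /F addrK gaussE -/C /hmc_step e1 mul1r.
  apply: (@le_trans _ _ ((C * expR (- (2^-1 * sqnorm z)))%:E *
    ((acc W G eps 1 (x, z))%:E * h (eps *: (z + w))%R))%E); last first.
    rewrite lee_wpmul2l ?lee_fin ?mulr_ge0 ?expR_ge0 ?(ltW C0)// leeDl//.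
    by rewrite mule_ge0// lee_fin subr_ge0 acc_le1.
  rewrite muleA muleA -!EFinM lee_wpmul2r// lee_fin -mulrA ler_pM2l//.
  apply: (@le_trans _ _ (expR (- (2^-1 * sqnorm z)) * expR (- (sqnorm z / 2)))).
    by rewrite -expRD ler_expR; lra.
  rewrite ler_wpM2l ?expR_ge0//; exact: (acc1_ge coco eps_lam (x, z)).
rewrite integral_lebRnD//.
have k0 : 0 <= C * expR (- (2 * B)) by rewrite mulr_ge0 ?expR_ge0// ltW.
have mh2 : measurable_fun setT
    (fun z : V => ((expR (- (2 * sqnorm z)))%:E * h (eps *: z)%R)%E).
  exact: emeasurable_funM.
have h20 (z : V) : (0 <= (expR (- (2 * sqnorm z)))%:E * h (eps *: z)%R)%E.
  by rewrite mule_ge0// lee_fin expR_ge0.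
rewrite -(ge0_integralZl_EFin _ measurableT (fun z _ => h20 z) mh2 k0).
apply: ge0_le_integral => //.
- by move=> z _; apply: mule_ge0; rewrite ?lee_fin.
- exact: emeasurable_funM.
move=> z _; rewrite /F !muleA -!EFinM lee_wpmul2r// lee_fin -mulrA ler_pM2l//.
rewrite -expRD ler_expR mul1r; have := sqnormB_le z w; lra.
Qed.

(** The excess is nonnegative, so both points lie in one sublevel set and obey the same lower bound.
    Adding the bounds produces [f + g >= t] inside a single Gaussian integral. *)
Lemma hop_minorizes r : exists2 a, 0 < a & minorizes hop (fun x => W x - m) a r.
Proof.
have [A A0 hA] := hop_lower r.
have [K K0 KE] := @integral_expR_sqnorm R d 2 (ltr0n R 2).
exists (A * K); first by rewrite mulr_gt0.
move=> f g t mf mg f0 g0 t0 fg x y xyr.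
have xr : W x - m <= r by have := W_ge y; lra.
have yr : W y - m <= r by have := W_ge x; lra.
apply: le_trans (leeD (hA x f xr mf f0) (hA y g yr mg g0)).
have mhe (h : V -> \bar R) : measurable_fun setT h ->
    measurable_fun setT (fun z : V => ((expR (- (2 * sqnorm z)))%:E * h (eps *: z)%R)%E).
  move=> mh; apply: emeasurable_funM => //.
  by apply: measurableT_comp => //; exact: measurable_scalemx.
have he0 (h : V -> \bar R) (z : V) : (forall y, 0 <= h y)%E ->
    (0 <= (expR (- (2 * sqnorm z)))%:E * h (eps *: z)%R)%E.
  by move=> h0; rewrite mule_ge0// lee_fin expR_ge0.
rewrite -ge0_muleDr; last 2 first.
- by apply: integral_ge0 => z _; exact: he0.
- by apply: integral_ge0 => z _; exact: he0.
rewrite -mulrA EFinM lee_wpmul2l ?lee_fin ?(ltW A0)//.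
rewrite -ge0_integralD//; [|by move=> z _; exact: he0|exact: mhe|by move=> z _; exact: he0|exact: mhe].
rewrite mulrC EFinM -KE -ge0_integralZl_EFin//.
apply: ge0_le_integral => //.
- by move=> z _; rewrite mule_ge0 ?lee_fin ?expR_ge0.
- exact: emeasurable_funM.
- by apply: emeasurable_funD; exact: mhe.
by move=> z _; rewrite -ge0_muleDr// muleC lee_wpmul2l ?lee_fin ?expR_ge0.
Qed.

End minorization.

(** * Invariance of the target *)

Section phase_space.
Context {R : realType} {d : nat}.
Notation V := 'rV[R]_d.
Notation mu := (@lebRn R d).
Local Open Scope ereal_scope.

Definition preserves_volume (phi : V * V -> V * V) :=
  measurable_fun setT phi /\
  forall F : V * V -> \bar R, measurable_fun setT F -> (forall w, 0 <= F w) ->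
    \int[mu \x mu]_w F (phi w) = \int[mu \x mu]_w F w.

Lemma preserves_volume_comp phi psi :
  preserves_volume phi -> preserves_volume psi -> preserves_volume (phi \o psi).
Proof.
move=> [mphi hphi] [mpsi hpsi]; split; first exact: measurableT_comp.
move=> F mF F0; have mFp := measurableT_comp mF mphi.
apply: etrans _ (hphi F mF F0).
exact: (hpsi (F \o phi) mFp (fun w => F0 _)).
Qed.

(** A shear: at fixed position it translates the momentum, so Tonelli reduces it to translation
    invariance and no Jacobian appears. The drift is the same with the roles exchanged. *)
Lemma preserves_volume_kick (k : V -> V) : measurable_fun setT k ->
  preserves_volume (fun w => (w.1, w.2 + k w.1)%R).
Proof.
move=> mk; set phi := (fun w => _).
have mphi : measurable_fun setT phi.
  apply: measurable_fun_pair => //.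
  by apply: measurable_addmx => //; exact: measurableT_comp.
split => // F mF F0; have mFp := measurableT_comp mF mphi.
rewrite (fubini_tonelli1 (F \o phi) mFp (fun w => F0 _)).
rewrite (fubini_tonelli1 F mF F0); apply: eq_integral => x _.
rewrite /fubini_F /= (integral_lebRnD (k x) (f := fun z => F (x, z)))//.
exact: (measurable_fun_pair2 x mF).
Qed.

Lemma preserves_volume_drift (c : R) :
  preserves_volume (fun w => (w.1 + c *: w.2, w.2)%R).
Proof.
set phi := (fun w => _).
have mphi : measurable_fun setT phi.
  apply: measurable_fun_pair => //.
  by apply: measurable_addmx => //; exact: measurable_scalemx.
split => // F mF F0; have mFp := measurableT_comp mF mphi.
rewrite (fubini_tonelli2 (F \o phi) mFp (fun w => F0 _)).
rewrite (fubini_tonelli2 F mF F0); apply: eq_integral => z _.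
rewrite /fubini_G /= (integral_lebRnD (c *: z)%R (f := fun x => F (x, z)))//.
exact: (measurable_fun_pair1 z mF).
Qed.

Lemma preserves_volume_flip : preserves_volume (@flip R d).
Proof.
have mphi : measurable_fun setT (@flip R d).
  by apply: measurable_fun_pair => //; exact: measurable_oppmx.
split => // F mF F0; have mFp := measurableT_comp mF mphi.
rewrite (fubini_tonelli1 (F \o @flip R d) mFp (fun w => F0 _)).
rewrite (fubini_tonelli1 F mF F0); apply: eq_integral => x _.
rewrite /fubini_F /= (integral_lebRnN (f := fun z => F (x, z)))//.
exact: (measurable_fun_pair2 x mF).
Qed.

Lemma preserves_volume_lf (G : V -> V) (eps : R) L : measurable_fun setT G ->
  preserves_volume (lf G eps L).
Proof.
move=> mG.
have pk : preserves_volume (fun w => (w.1, w.2 - (eps / 2) *: G w.1)%R).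
  apply: (@preserves_volume_kick (fun x => - ((eps / 2) *: G x))%R).
  by apply: measurable_oppmx; exact: measurable_scalemx.
have p1 : preserves_volume (lf1 G eps).
  exact: (preserves_volume_comp pk
    (preserves_volume_comp (preserves_volume_drift eps) pk)).
elim: L => [|L IH]; first by split => //; exact: measurable_id.
exact: (preserves_volume_comp p1 IH).
Qed.

End phase_space.

Section invariance.
Context {R : realType} {d : nat}.
Notation V := 'rV[R]_d.
Notation mu := (@lebRn R d).
Variables (W : V -> R) (G : V -> V) (eps : R).
Hypothesis mW : measurable_fun setT W.
Hypothesis mG : measurable_fun setT G.
Variable pL : nat -> R.
Hypothesis pL_ge0 : forall L, 0 <= pL L.
Hypothesis pL_sum : (\sum_(0 <= L <oo) (pL L)%:E)%E = 1%E.
Notation hop := (hop W G eps pL).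
Notation hmc_move := (hmc_move W G eps).
Notation acc := (acc W G eps).
Notation lf := (lf G eps).

(** [wt] and [wr] split the unnormalised phase-space density into its accepted and rejected
    parts. *)
Let wt L (w : V * V) : R := expR (- W w.1) * gauss w.2 * acc L w.
Let wr L (w : V * V) : R := expR (- W w.1) * gauss w.2 * (1 - acc L w).

Let gauss0 (z : V) : 0 <= gauss z. Proof. by rewrite ltW// gauss_gt0. Qed.

Let wt0 L w : 0 <= wt L w.
Proof. by apply: mulr_ge0; [rewrite mulr_ge0 ?expR_ge0|exact: acc_ge0]. Qed.

Let wr0 L w : 0 <= wr L w.
Proof.
by apply: mulr_ge0; [rewrite mulr_ge0 ?expR_ge0|rewrite subr_ge0 acc_le1].
Qed.

(** Detailed balance. The accepted density is a constant times the minimum of [expR (- ham)] at [w]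
    and at its image; the flip preserves [ham] and the flipped flow is an involution, so the two
    arguments are merely exchanged. *)
Let wt_flip_lf L w : wt L (flip (lf L w)) = wt L w.
Proof.
pose C : R := (2 * pi) `^ (- (d%:R / 2)).
have wtE v : wt L v = C * Num.min (expR (- ham W v)) (expR (- ham W (lf L v))).
  rewrite /wt gaussE mulrCA -/C -!mulrA; congr (C * _); rewrite mulrA -expRD.
  rewrite (_ : - W v.1 + _ = - ham W v); last by rewrite /ham; lra.
  rewrite /acc minr_pMr ?expR_ge0// mulr1 -expRD; congr (Num.min _ (expR _)).
  by move: (ham W _) (ham W v) => p q; lra.
rewrite !wtE; congr (C * _).
have -> : ham W (lf L (flip (lf L w))) = ham W w.
  by rewrite -ham_flip; congr (ham W _); exact: (flip_lfK G eps L w).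
by rewrite ham_flip minC.
Qed.

Let mwt L : measurable_fun setT (wt L).
Proof.
apply: measurable_funM; last exact: measurable_acc.
apply: measurable_funM.
  by apply: measurableT_comp => //; apply: measurableT_comp => //; exact: measurableT_comp.
by apply: measurableT_comp => //; exact: measurable_gauss.
Qed.

Let mwr L : measurable_fun setT (wr L).
Proof.
apply: measurable_funM; last first.
  by apply: measurable_funB => //; exact: measurable_acc.
apply: measurable_funM.
  by apply: measurableT_comp => //; apply: measurableT_comp => //; exact: measurableT_comp.
by apply: measurableT_comp => //; exact: measurable_gauss.
Qed.

Variable f : V -> \bar R.
Hypothesis mf : measurable_fun setT f.
Hypothesis f0 : forall x, (0 <= f x)%E.
Local Open Scope ereal_scope.

Let mf1 : measurable_fun (setT : set (V * V)) (fun w => f w.1).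
Proof. exact: measurableT_comp. Qed.

Let mwtf L : measurable_fun setT (fun w => (wt L w)%:E * f w.1).
Proof. by apply: emeasurable_funM => //; exact/measurable_EFinP. Qed.

Let mwrf L : measurable_fun setT (fun w => (wr L w)%:E * f w.1).
Proof. by apply: emeasurable_funM => //; exact/measurable_EFinP. Qed.

Let mwtlf L : measurable_fun setT (fun w => (wt L w)%:E * f (lf L w).1).
Proof.
apply: emeasurable_funM; first exact/measurable_EFinP.
apply: measurableT_comp => //; apply: measurableT_comp => //.
exact: measurable_lf.
Qed.

Let accept_flow L :
  \int[mu \x mu]_w ((wt L w)%:E * f (lf L w).1) =
  \int[mu \x mu]_w ((wt L w)%:E * f w.1).
Proof.
have [_ hpv] := preserves_volume_comp (@preserves_volume_flip R d)
  (preserves_volume_lf eps L mG).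
have wf0 w : 0 <= (wt L w)%:E * f w.1 by rewrite mule_ge0// lee_fin.
(* The flip leaves the position alone, so [f] at the end of the flow is [f] at the image under the
   volume-preserving involution. *)
apply: etrans _ (hpv _ (mwtf L) wf0).
by apply: eq_integral => w _; rewrite wt_flip_lf.
Qed.

Let mexW : measurable_fun setT (fun x => (expR (- W x))%:E).
Proof.
by apply/measurable_EFinP; apply: measurableT_comp => //; exact: measurableT_comp.
Qed.

Lemma hmc_move_invariant L :
  \int[mu]_x ((expR (- W x))%:E * hmc_move L f x) = \int[mu]_x ((expR (- W x))%:E * f x).
Proof.
have ewt w : 0 <= (wt L w)%:E * f w.1 by rewrite mule_ge0// lee_fin.
have ewr w : 0 <= (wr L w)%:E * f w.1 by rewrite mule_ge0// lee_fin.
have ewl w : 0 <= (wt L w)%:E * f (lf L w).1 by rewrite mule_ge0// lee_fin.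
have gs0 x z : 0 <= (gauss z)%:E * hmc_step W G eps L f (x, z).
  by rewrite mule_ge0 ?lee_fin// hmc_step_ge0.
transitivity (\int[mu \x mu]_w ((wt L w)%:E * f (lf L w).1 + (wr L w)%:E * f w.1)).
  rewrite (fubini_tonelli1 (fun w => (wt L w)%:E * f (lf L w).1 + (wr L w)%:E * f w.1))//.
  - apply: eq_integral => x _; rewrite /fubini_F /hmc_move -ge0_integralZl_EFin//.
    + apply: eq_integral => z _; rewrite /hmc_step ge0_muleDr; last 2 first.
      * by rewrite mule_ge0// lee_fin acc_ge0.
      * by rewrite mule_ge0// lee_fin subr_ge0 acc_le1.
      rewrite ge0_muleDr; last 2 first.
      * by rewrite !mule_ge0// lee_fin// acc_ge0.
      * by rewrite !mule_ge0// lee_fin// subr_ge0 acc_le1.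
      by rewrite !muleA -!EFinM.
    + exact: measurable_gstepz.
  - exact: emeasurable_funD.
  - by move=> w; rewrite adde_ge0.
(* Once the accepted mass has been carried back, [wt + wr] is the full density and the momentum
   integrates out to 1. *)
rewrite ge0_integralD// accept_flow -ge0_integralD//.
rewrite (fubini_tonelli1 (fun w => (wt L w)%:E * f w.1 + (wr L w)%:E * f w.1))//; last 2 first.
- exact: emeasurable_funD.
- by move=> w; rewrite adde_ge0.
apply: eq_integral => x _; rewrite /fubini_F.
have mgz : measurable_fun setT (fun z : V => (gauss z : R)%:E).
  by apply/measurable_EFinP; exact: measurable_gauss.
transitivity (\int[mu]_z ((expR (- W x))%:E * f x * (gauss z)%:E)).
  apply: eq_integral => z _; rewrite -ge0_muleDl ?lee_fin// -EFinD.
  rewrite muleAC -EFinM; congr (_%:E * _); rewrite /wt /wr /=; ring.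
rewrite ge0_integralZl//; last by rewrite mule_ge0// lee_fin expR_ge0.
  by rewrite integral_gauss mule1.
by move=> z _; rewrite lee_fin.
Qed.

Lemma hop_invariant (r : R) : \int[mu]_x ((expR (- W x))%:E * f x) = r%:E ->
  \int[mu]_x ((expR (- W x))%:E * hop f x) = r%:E.
Proof.
move=> rE.
have e0 x : 0 <= (expR (- W x))%:E by rewrite lee_fin expR_ge0.
have pm0 L x : 0 <= (pL L)%:E * hmc_move L f x by rewrite mule_ge0 ?lee_fin ?hmc_move_ge0.
have mm L : measurable_fun setT (hmc_move L f) by exact: measurable_hmc_move.
transitivity (\int[mu]_x \sum_(0 <= L <oo) (pL L)%:E * ((expR (- W x))%:E * hmc_move L f x)).
  apply: eq_integral => x _; rewrite hopE// -nneseriesZl//.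
  by apply: eq_eseriesr => L _; rewrite muleCA.
rewrite integral_nneseries//; last 2 first.
- by move=> L; apply: emeasurable_funM => //; exact: emeasurable_funM.
- by move=> L x _; rewrite !mule_ge0 ?lee_fin ?hmc_move_ge0.
under eq_eseriesr => L _.
  rewrite ge0_integralZl_EFin//; last 2 first.
  - by move=> x _; rewrite mule_ge0 ?hmc_move_ge0.
  - exact: emeasurable_funM.
  rewrite hmc_move_invariant rE muleC; over.
by rewrite nneseriesZl ?pL_sum ?mule1// => *; rewrite lee_fin.
Qed.

End invariance.

(** * Geometric ergodicity *)

Section abstract_ergodicity.
Context {R : realType} {d : nat}.
Notation V := 'rV[R]_d.
Notation mu := (@lebRn R d).
Variables (W : V -> R) (G : V -> V) (lam eps : R).
Hypothesis mW : measurable_fun setT W.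
Hypothesis mG : measurable_fun setT G.
Hypothesis lam0 : 0 < lam.
Hypothesis coco : cocoercive lam W G.
Hypothesis eps0 : 0 < eps.
Hypothesis eps_lam : eps ^+ 2 <= 2 * lam.
Variable pL : nat -> R.
Hypothesis pL_ge0 : forall L, 0 <= pL L.
Hypothesis pL_sum : (\sum_(0 <= L <oo) (pL L)%:E)%E = 1%E.
Hypothesis pL1 : 0 < pL 1%N.
Variables m b1 b2 B1 B2 c1 c2 : R.
Hypothesis W_ge : forall x, m <= W x.
Hypothesis b1_gt0 : 0 < b1.
Hypothesis W_quad : forall x, b1 * sqnorm x - b2 <= W x.
Hypothesis B1_gt0 : 0 < B1.
Hypothesis W_le : forall x, W x <= B2 + B1 * sqnorm x.
Hypothesis c1_gt0 : 0 < c1.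
Hypothesis G_ge : forall x, c1 * (W x - m) - c2 <= sqnorm (G x).
Notation hop := (hop W G eps pL).

Let wgt x := expR (- W x).

Let wgt0 x : 0 <= wgt x. Proof. exact: expR_ge0. Qed.

Let mwgt : measurable_fun setT wgt.
Proof. by apply: measurableT_comp => //; exact: measurableT_comp. Qed.

Let excess x := W x - m.

Let excess_ge0 x : 0 <= excess x. Proof. by rewrite subr_ge0. Qed.

Let mexcess : measurable_fun setT excess.
Proof. exact: measurable_funB. Qed.

Let mE (u : V -> R) : measurable_fun setT u -> measurable_fun setT (EFin \o u).
Proof. by move=> mu_; exact/measurable_EFinP. Qed.

Let finite_of_le (u : V -> R) (c k : R) : measurable_fun setT u ->
  (forall x, 0 <= u x) -> 0 < k -> (forall x, u x <= c * expR (- (k * sqnorm x))) ->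
  exists2 r : R, 0 <= r & (\int[mu]_x (u x)%:E = r%:E)%E.
Proof.
move=> mu_ u0 k0 uc.
have [K K0 KE] := @integral_expR_sqnorm R d k k0.
have c0 : 0 <= c.
  have := le_trans (u0 0) (uc 0); rewrite pmulr_lge0 ?expR_gt0//.
set I := (\int[mu]_x _)%E.
have I0 : (0 <= I)%E by apply: integral_ge0 => x _; rewrite lee_fin.
have me := mE (@measurable_expR_sqnorm R d k).
have : (I <= (c * K)%:E)%E.
  rewrite EFinM -KE -ge0_integralZl_EFin//.
  apply: ge0_le_integral => //.
  - by move=> x _; rewrite lee_fin.
  - exact: mE.
  - exact: emeasurable_funM.
  - by move=> x _; rewrite -EFinM lee_fin.
by move: I0; case: I => [r||]// r0 _; exists r.
Qed.

(** The quadratic lower bound on [W] gives finiteness, the quadratic upper bound positivity. *)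
Let Z_finite : exists2 Z : R, 0 < Z & (\int[mu]_x (wgt x)%:E = Z%:E)%E.
Proof.
have [Z Z0 ZE] : exists2 r : R, 0 <= r & (\int[mu]_x (wgt x)%:E = r%:E)%E.
  apply: (finite_of_le (c := expR b2) (k := b1)) => // x.
  by rewrite -expRD ler_expR; have := W_quad x; lra.
exists Z => //.
have [K K0 KE] := @integral_expR_sqnorm R d B1 B1_gt0.
have me := mE (@measurable_expR_sqnorm R d B1).
rewrite -lte_fin -ZE; apply: (@lt_le_trans _ _ (expR (- B2) * K)%:E).
  by rewrite lte_fin mulr_gt0// expR_gt0.
rewrite EFinM -KE -ge0_integralZl_EFin ?expR_ge0//.
apply: ge0_le_integral => //.
- exact: emeasurable_funM.
- exact: mE.
- move=> x _; rewrite -EFinM lee_fin -expRD ler_expR.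
  by have := W_le x; lra.
Qed.

(** Since [u <= 2 expR (u / 2)], the excess costs half of the decay of [expR (- W)]; the other half
    is still Gaussian. *)
Let J_finite : exists2 J : R, 0 <= J & (\int[mu]_x (wgt x * excess x)%:E = J%:E)%E.
Proof.
apply: (finite_of_le (c := 2 * expR (b2 / 2 - m / 2)) (k := b1 / 2)).
- exact: measurable_funM.
- by move=> x; rewrite mulr_ge0.
- by rewrite divr_gt0.
move=> x; have h : excess x <= 2 * expR (excess x / 2).
  by have := expR_ge1Dx (excess x / 2); lra.
apply: (le_trans (ler_wpM2l (wgt0 x) h)).
rewrite mulrCA -[leRHS]mulrA ler_pM2l// /wgt -!expRD ler_expR /excess.
by have := W_quad x; lra.
Qed.

Let weighted_affine Z J p T k (u : V -> R) :
  (\int[mu]_x (wgt x)%:E = Z%:E)%E ->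
  (\int[mu]_x (wgt x * excess x)%:E = J%:E)%E ->
  measurable_fun setT u -> (forall x, 0 <= u x) -> 0 <= T -> 0 <= k ->
  (\int[mu]_x (wgt x * u x)%:E = p%:E)%E ->
  (\int[mu]_x (wgt x * (u x + (T + k * excess x)))%:E = (p + (T * Z + k * J))%:E)%E.
Proof.
move=> ZE JE mu_ u0 T0 k0 pE.
have m1 : measurable_fun setT (fun x => (wgt x * u x)%:E).
  by apply: mE; exact: measurable_funM.
have m2 := mE mwgt.
have m3 : measurable_fun setT (fun x => (wgt x * excess x)%:E).
  by apply: mE; exact: measurable_funM.
have n1 x : (0 <= (wgt x * u x)%:E)%E by rewrite lee_fin mulr_ge0.
have n2 x : (0 <= (wgt x)%:E)%E by rewrite lee_fin.
have n3 x : (0 <= (wgt x * excess x)%:E)%E by rewrite lee_fin mulr_ge0.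
have T0' : (0 <= T%:E)%E by rewrite lee_fin.
have k0' : (0 <= k%:E)%E by rewrite lee_fin.
transitivity (\int[mu]_x ((wgt x * u x)%:E +
    (T%:E * (wgt x)%:E + k%:E * (wgt x * excess x)%:E)))%E.
  by apply: eq_integral => x _; rewrite -!EFinM -!EFinD; congr EFin; ring.
have m4 : measurable_fun setT (fun x => (T%:E * (wgt x)%:E)%E) by exact: emeasurable_funM.
have m5 : measurable_fun setT (fun x => (k%:E * (wgt x * excess x)%:E)%E).
  exact: emeasurable_funM.
have n4 x : (0 <= T%:E * (wgt x)%:E)%E by rewrite mule_ge0.
have n5 x : (0 <= k%:E * (wgt x * excess x)%:E)%E by rewrite mule_ge0.
have m6 : measurable_fun setT
  (fun x => (T%:E * (wgt x)%:E + k%:E * (wgt x * excess x)%:E)%E).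
  exact: emeasurable_funD.
have n6 x : (0 <= T%:E * (wgt x)%:E + k%:E * (wgt x * excess x)%:E)%E.
  by rewrite adde_ge0.
rewrite ge0_integralD// ge0_integralD//.
rewrite (ge0_integralZl_EFin _ measurableT (fun x _ => n2 x) m2 T0).
rewrite (ge0_integralZl_EFin _ measurableT (fun x _ => n3 x) m3 k0).
by rewrite pE ZE JE -!EFinM -!EFinD.
Qed.

(** Harris' theorem compares the iterates started at [x] and at [y]. Integrating in [y] against the
    target, invariance turns the iterate at [y] into the probability of [A], and the excess of [y]
    into [J / Z], which is where the prefactor comes from. *)
Lemma hop_geometric : exists (rho : R) (M : V -> R), 0 <= rho < 1 /\
  forall (x : V) (n : nat) (A : set V), measurable A ->
  (`| iter n hop (fun y => (\1_A y : R)%:E) x -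
      (fine (\int[mu]_y ((\1_A y : R)%:E * (wgt y)%:E)) /
       fine (\int[mu]_y (wgt y)%:E))%:E | <= (M x * rho ^+ n)%:E)%E.
Proof.
have c2'0 : 0 <= Num.max 0 c2 by rewrite le_max lexx.
have G_ge' x : c1 * (W x - m) - Num.max 0 c2 <= sqnorm (G x).
  by apply: le_trans (G_ge x); rewrite lerD2l lerN2 le_max lexx orbT.
have [gam [K [gam1 K0 drift]]] := hop_drift mW mG lam0 coco eps0 eps_lam
  pL_ge0 pL_sum pL1 W_ge c1_gt0 c2'0 G_ge'.
have minor := hop_minorizes mW mG lam0 coco eps0 eps_lam pL_ge0 pL1 W_ge
  b1_gt0 W_quad.
have mhop := measurable_hop eps mW mG pL_ge0.
have hop0 := @hop_ge0 R d W G eps pL pL_ge0.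
have [rho [b [rho0 rho1 b0 H]]] := harris mhop hop0 (hopD eps mW mG pL_ge0)
  (hopZ eps mW mG pL_ge0) (hop_cst eps mW mG pL_ge0 pL_sum) (hop_le eps mW mG pL_ge0)
  mexcess excess_ge0 gam1 K0 drift minor.
have [Z Z0 ZE] := Z_finite; have [J J0 JE] := J_finite.
exists rho, (fun x => 2 + b * excess x + b * (J / Z)); split; first exact/andP.
move=> x n A mA.
have mf : measurable_fun setT (\1_A : V -> R) by exact: measurable_indic.
have f01 y : 0 <= (\1_A y : R) <= 1.
  by rewrite indicE; case: (_ \in _); rewrite ?lexx ?ler01.
have [p p0 pE] : exists2 p : R, 0 <= p & (\int[mu]_y (wgt y * \1_A y)%:E = p%:E)%E.
  apply: (finite_of_le (c := expR b2) (k := b1)) => //.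
  - exact: measurable_funM.
  - by move=> y; rewrite mulr_ge0//; case/andP: (f01 y).
  move=> y; apply: (@le_trans _ _ (wgt y)).
    by rewrite ler_piMr//; case/andP: (f01 y).
  by rewrite -expRD ler_expR; have := W_quad y; lra.
have -> : (\int[mu]_y ((\1_A y : R)%:E * (wgt y)%:E) = p%:E)%E.
  by rewrite -pE; apply: eq_integral => y _; rewrite -EFinM mulrC.
rewrite ZE /=.
(* Invariance is applied once per iterate; the contraction lemma supplies the measurability and the
   bounds of each iterate. *)
have inv k : (\int[mu]_y ((wgt y)%:E * iter k hop (EFin \o \1_A) y) = p%:E)%E.
  elim: k => [|k IH]; first by rewrite -pE.
  have [fk [fkE mfk fk01 _]] := H \1_A k mf f01.
  rewrite iterS; apply: hop_invariant => //; rewrite fkE; first exact: mE.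
  by move=> y; rewrite lee_fin; case/andP: (fk01 y).
have [fn [fnE mfn fn01 osc]] := H \1_A n mf f01.
have -> : iter n hop (fun y => (\1_A y : R)%:E) = EFin \o fn by exact: fnE.
have fn0 y : 0 <= fn y by case/andP: (fn01 y).
have pnE : (\int[mu]_y (wgt y * fn y)%:E = p%:E)%E by rewrite -(inv n) fnE.
have cE : (\int[mu]_y (wgt y * fn x)%:E = (Z * fn x)%:E)%E.
  have mw := mE mwgt.
  rewrite mulrC EFinM -ZE -ge0_integralZl_EFin ?fn0//; last first.
    by move=> y _; rewrite lee_fin.
  by apply: eq_integral => y _; rewrite -EFinM mulrC.
have rn0 : 0 <= rho ^+ n by rewrite exprn_ge0.
pose T := rho ^+ n * (2 + b * excess x); pose k := rho ^+ n * b.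
have T0 : 0 <= T by rewrite mulr_ge0// addr_ge0// mulr_ge0.
have k0 : 0 <= k by rewrite mulr_ge0.
(* The two-sided estimate is obtained as two inequalities between integrals of nonnegative
   functions, with the error term added on the larger side. *)
have le_int (u v : V -> R) : measurable_fun setT u -> (forall y, 0 <= u y) ->
    measurable_fun setT v -> (forall y, u y <= v y + (T + k * excess y)) ->
    (\int[mu]_y (wgt y * u y)%:E <= \int[mu]_y (wgt y * (v y + (T + k * excess y)))%:E)%E.
  move=> mu_ u0 mv uv; apply: ge0_le_integral => //.
  - by move=> y _; rewrite lee_fin mulr_ge0.
  - by apply: mE; exact: measurable_funM.
  - apply: mE; apply: measurable_funM => //; apply: measurable_funD => //.
    by apply: measurable_funD => //; exact: measurable_funM.
  - by move=> y _; rewrite lee_fin ler_wpM2l.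
have mc : measurable_fun setT (fun _ : V => fn x) by exact: measurable_cst.
have up : Z * fn x <= p + (T * Z + k * J).
  rewrite -lee_fin -cE -(weighted_affine ZE JE mfn fn0 T0 k0 pnE).
  apply: (le_int (fun=> fn x)) => // y.
  by have := osc x y; rewrite /T /k; move: (fn x) (fn y) (excess x) (excess y) => *; lra.
have dn : p <= Z * fn x + (T * Z + k * J).
  rewrite -lee_fin -pnE -(weighted_affine ZE JE mc (fun=> fn0 x) T0 k0 cE).
  apply: le_int => // y.
  by have := osc y x; rewrite /T /k; move: (fn x) (fn y) (excess x) (excess y) => *; lra.
rewrite -[X in (X <= _)%E]/(`|fn x - p / Z|%:E) lee_fin.
have -> : (2 + b * excess x + b * (J / Z)) * rho ^+ n = (T * Z + k * J) / Z.
  by rewrite /T /k; field; rewrite gt_eqF.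
have -> : fn x - p / Z = (Z * fn x - p) / Z by field; rewrite gt_eqF.
rewrite normrM [`|Z^-1|]gtr0_norm ?invr_gt0// ler_pM2r ?invr_gt0//.
rewrite ler_norml; apply/andP; split.
  by move: dn; move: (T * Z + _) (Z * _) => s t; lra.
by move: up; move: (T * Z + _) (Z * _) => s t; lra.
Qed.

End abstract_ergodicity.

Theorem theorem7 (R : realType) (d : nat) (psi : 'rV[R]_d -> \bar R)
  (lam : R) (pL : nat -> R) :
  proper_fun psi -> closed_fun psi -> convex_fun psi -> bounded_below psi ->
  (intRn (fun x => expeR (- psi x)%E) < +oo)%E ->
  0 < lam ->
  (* distribution of the number L >= 1 of leapfrog steps *)
  (forall n, 0 <= pL n) -> pL 0%N = 0 ->
  (\sum_(0 <= n <oo) (pL n)%:E)%E = 1%E ->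
  (* assumption (i) *)
  (exists l : R, limsup_infty (fun x => enorm (prox psi lam x) / enorm x) = l%:E
                 /\ l < 1) ->
  (* assumption (ii) *)
  0 < pL 1%N ->
  (forall (x0 z0 : 'rV[R]_d) (eps : R), 0 < eps ->
     exists s : R, 0 < s /\
       (\sum_(0 <= L <oo) (pL L)%:E *
          (expR (s * enorm (leapfrog psi lam eps L x0 z0).1))%:E < +oo)%E) ->
  exists eps0 : R, 0 < eps0 /\
  forall eps : R, 0 < eps < eps0 ->
  forall q : 'rV[R]_d -> 'rV[R]_d -> R,
    is_proposal_density psi lam eps pL q ->
    (forall e : R, 0 < e -> exists M : R, forall x, M < enorm x ->
       (intRn (fun y =>
          ((\1_([set y | pi_dens psi lam y * q y x <= pi_dens psi lam x * q x y]
                `&` [set y | enorm y <= enorm x]) y : R) * q x y)%:E) <= e%:E)%E) ->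
    geometrically_ergodic psi lam eps pL.
Proof.
move=> psi_proper psi_closed psi_convex [m psi_ge] _ lam0 pL_ge0 _ pL_sum
  [l [limsup_l l1]] pL1 _.
have [a [r [a0 a1 prox_le]]] := limsup_infty_ratio_lt1 limsup_l l1.
have coco := menv_cocoercive psi_proper psi_closed psi_convex lam0 psi_ge.
have W_ge := menv_ge psi_proper psi_closed lam0 psi_ge.
have W_le := menv_le psi_proper psi_closed psi_convex lam0 psi_ge.
have [b1 [b2 [b1_gt0 W_quad]]] := menv_quadratic_ge psi_proper psi_closed
  psi_convex lam0 psi_ge a0 a1 prox_le.
have [c1 [c2 [c1_gt0 G_ge]]] := sqnorm_grad_ge_menv psi_proper psi_closed
  psi_convex lam0 psi_ge a0 a1 prox_le.
have mW : measurable_fun setT (menv psi lam).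
  by apply: continuous_measurable_mx; exact: (coco_continuous lam0 coco).
have mG : measurable_fun setT (grad_moreau psi lam).
  apply: measurable_mx => i j; rewrite (_ : i = ord0); last exact: ord1.
  apply: continuous_measurable_mx.
  exact: (coco_coord_continuous lam0 coco).
exists (Num.sqrt (2 * lam)); split; first by rewrite sqrtr_gt0 mulr_gt0.
move=> eps /andP[eps0 eps_lt] _ _ _.
have eps_lam : eps ^+ 2 <= 2 * lam.
  rewrite -[leRHS]sqr_sqrtr; last by rewrite mulr_ge0// ltW.
  by rewrite ler_pXn2r ?nnegrE ?sqrtr_ge0 ?(ltW eps0)// ltW.
have B1_gt0 : 0 < 2^-1 + (2 * lam)^-1 by rewrite addr_gt0// invr_gt0// mulr_gt0.
have [rho [M [rho01 H]]] := hop_geometric mW mG lam0 coco eps0 eps_lam pL_ge0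
  pL_sum pL1 W_ge b1_gt0 W_quad B1_gt0 W_le c1_gt0 G_ge.
have piE x : pi_unnorm psi lam x = (expR (- menv psi lam x))%:E.
  by rewrite /pi_unnorm /menv (moreauE psi_proper psi_closed lam0 psi_ge).
have mpi : measurable_fun setT (pi_unnorm psi lam).
  rewrite (_ : pi_unnorm psi lam = fun x => (expR (- menv psi lam x))%:E).
    apply/measurable_EFinP; apply: measurableT_comp => //.
    exact: measurableT_comp.
  exact/funext.
have pi0 x : (0 <= pi_unnorm psi lam x)%E by rewrite piE lee_fin expR_ge0.
have piAE A : measurable A -> pi_prob psi lam A =
    fine (\int[lebRn d]_y ((\1_A y : R)%:E * (expR (- menv psi lam y))%:E))%E /
    fine (\int[lebRn d]_y (expR (- menv psi lam y))%:E)%E.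
  move=> mA; rewrite /pi_prob /pi_const -!lebRnE//.
  - by congr (fine _ / fine _); apply: eq_integral => y _; rewrite piE.
  - by apply: emeasurable_funM => //; apply/measurable_EFinP; exact: measurable_indic.
  - by move=> y; rewrite mule_ge0// lee_fin indicE ler0n.
(* The bound holds from every starting point, so the exceptional null set is empty. *)
exists rho, M; split => //; exists set0; split.
  exact: (@measurable0 _ 'rV[R]_d).
split.
  rewrite piAE//; under eq_integral do rewrite indicE in_set0 mul0e.
  by rewrite integral0 mul0r.
move=> x _ n A mA; rewrite piAE//.
(* At [W = menv psi lam] and [G = grad_moreau psi lam], [hop] is convertible to [hmc_op], so the
   abstract bound is the goal. *)
exact: H x n A mA.
Qed.
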